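(* Let $\mathcal{A}$, $L$, $\mathcal{C}$, $\mathcal{A}_1$ be a web-like system (as described in the context), let $\nu_0\in\mathcal{C}$, and let $u\in C^1([0,1],\ell^2(\mathcal{A}))$ be a solution of $$\partial_t u(t,\alpha)=i\sum_{\beta\in\mathcal{A}}L(\alpha,\beta)u(t,\beta),\qquad t\in[0,1],\ \alpha\in\mathcal{A},$$ such that for all $\nu\in\mathcal{C}\setminus\{\nu_0\}$ and some $\epsilon>0$ and some constant $C>0$ $$|u(t,\nu(k))|\le C\Big(\frac{e}{(2+\epsilon)k}\Big)^k,\qquad k>0,\quad t\in\{0,1\}.$$ If in addition $[\mathcal{B}]=\mathcal{F}$, where $$\mathcal{B}=\bigcup_{j=0,1}\ \bigcup_{\nu\in\mathcal{C}\setminus\{\nu_0\}}\{\nu(j)\}\quad\text{and}\quad \mathcal{F}=\mathcal{A}_1\cup\{\nu(1)\}_{\nu\in\mathcal{C}},$$ then $u(t,\alpha)=0$ for all $\alpha\in\mathcal{A}$ and $t\in[0,1]$.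
   Context: Web-like system. $\mathcal{A}$ is a countable set (of ''particles'' or vertices) and $L=(L(\alpha,\beta))_{\alpha,\beta\in\mathcal{A}}$ is a real-valued symmetric matrix defining a positive selfadjoint operator $L:\ell^2(\mathcal{A})\to\ell^2(\mathcal{A})$. Two distinct vertices $\alpha,\beta$ are joined by an edge iff $L(\alpha,\beta)\ne0$; the resulting graph is connected. There is a finite set $\mathcal{C}=\{\nu_1,\dots,\nu_N\}$ of channels; each channel $\nu\in\mathcal{C}$ is an infinite sequence $\nu=\{\nu(k)\}_{k\ge0}$ of vertices with $L(\nu(k),\nu(n))=0$ if $|n-k|>1$, and for each $k\ge1$ the vertex $\nu(k)$ is joined by an edge to $\nu(k-1)$ and $\nu(k+1)$ and to no other vertex. Put $\mathcal{A}_0=\bigcup_{\nu\in\mathcal{C}}\bigcup_{k\ge1}\{\nu(k)\}$ (the vertices $\nu(k)$, $\nu\in\mathcal{C}$, $k\ge1$, being pairwise distinct) and $\mathcal{A}_1=\mathcal{A}\setminus\mathcal{A}_0$. The set $\mathcal{A}_1$ is finite, contains all $\nu(0)$, $\nu\in\mathcal{C}$, and the only pairs $(\alpha,\beta)\in\mathcal{A}_1\times\mathcal{A}_0$ with $L(\alpha,\beta)\neq0$ are $(\nu(0),\nu(1))$, $\nu\in\mathcal{C}$. For $\nu\in\mathcal{C}$ and $k\ge1$ write $-b_\nu(k-1)=L(\nu(k-1),\nu(k))$ and $a_\nu(k)=L(\nu(k),\nu(k))$. It is assumed that there is $K_0>0$ such that $b_\nu(k)=1$ and $a_\nu(k)=2$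 for all $k\ge K_0$ and all $\nu\in\mathcal{C}$. Extension of a subset. The finite set $\mathcal{F}$ is regarded as a graph $(\mathcal{F},\Pi)$ with edges $(\alpha,\beta)\in\Pi$ for $\alpha,\beta\in\mathcal{F}$, $\alpha\ne\beta$, $L(\alpha,\beta)\neq0$. For $\mathcal{D}\subset\mathcal{F}$: if $\beta\in\mathcal{D}$ is such that there is a unique $\alpha\in\mathcal{F}\setminus\mathcal{D}$ with $(\alpha,\beta)\in\Pi$, then $\mathcal{D}^{(1)}=\mathcal{D}\cup\{\alpha\}$ is called an extension of $\mathcal{D}$. Iterating, $\mathcal{D}^{(k+1)}=(\mathcal{D}^{(k)})^{(1)}$, one gets chains $\mathcal{D}\subset\mathcal{D}^{(1)}\subset\dots\subset\mathcal{D}^{(p)}$; if $\mathcal{D}^{(p)}$ has no extension it is called maximal. All maximal chains starting at $\mathcal{D}$ end with the same set, denoted $[\mathcal{D}]$. *)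

(* Defs.v *)
From HB Require Import structures.
From mathcomp Require Export all_boot all_order all_algebra.
From mathcomp Require Export complex.
From mathcomp Require Import finmap.
From mathcomp Require Export all_classical all_reals all_analysis.
Set Implicit Arguments.
Unset Strict Implicit.
Unset Printing Implicit Defensive.
Import Order.TTheory GRing.Theory Num.Theory.
Export numFieldNormedType.Exports.

Local Open Scope classical_set_scope.
Local Open Scope complex_scope.
Local Open Scope ring_scope.

Section SquareSummable.
Context {R : realType} {A : countType}.
Implicit Types (f g : A -> R[i]) (t : R).

Local Notation normc := ComplexField.Normc.normc.

(* Sums of absolutely summable families; not meaningful (because of [fine])
   when the family is not absolutely summable. *)
Definition rsum (x : A -> R) : R :=
  fine (\esum_(a in [set: A]) (x^\+ a)%:E) -
  fine (\esum_(a in [set: A]) (x^\- a)%:E).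

Definition csum f : R[i] :=
  rsum (fun a => complex.Re (f a)) +i* rsum (fun a => complex.Im (f a)).

Definition ell2 f : Prop :=
  (\esum_(a in [set: A]) (normc (f a) ^+ 2)%:E < +oo)%E.

Definition ell2_norm f : R :=
  Num.sqrt (fine (\esum_(a in [set: A]) (normc (f a) ^+ 2)%:E)).

Definition ell2_inner f g : R[i] := csum (fun a => f a * (g a)^*).

(* Every row of the matrix of a web-like system has finite support, so this
   sum is then a finite one for every f. *)
Definition matrix_action (L : A -> A -> R) f : A -> R[i] :=
  fun a => csum (fun b => (L a b)%:C * f b).

(* For an operator defined on all of ell^2, selfadjointness is the symmetry of
   its form; boundedness is then automatic (Hellinger-Toeplitz).
   [0 <= z] in [R[i]] means that z is real and nonnegative. *)
Definition positive_selfadjoint (L : A -> A -> R) : Prop :=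
  [/\ forall f, ell2 f -> ell2 (matrix_action L f),
      forall f g, ell2 f -> ell2 g ->
        ell2_inner (matrix_action L f) g = ell2_inner f (matrix_action L g)
    & forall f, ell2 f -> 0 <= ell2_inner (matrix_action L f) f].

(* u is in C^1([0,1], ell^2(A)) with derivative u'; limits are in the norm of
   ell^2 and one-sided at 0 and 1. Values at times outside [0,1] play no role. *)
Definition C1_ell2 (u u' : R -> A -> R[i]) : Prop :=
  [/\ forall t : R, t \in `[0, 1] -> ell2 (u t),
      forall t : R, t \in `[0, 1] -> ell2 (u' t),
      forall t : R, t \in `[0, 1] ->
        ell2_norm (fun a => ((s - t)^-1)%:C * (u s a - u t a) - u' t a)
          @[s --> within `[0, 1] t^'] --> (0 : R)
    & forall t : R, t \in `[0, 1] ->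
        ell2_norm (fun a => u' s a - u' t a)
          @[s --> within `[0, 1] (nbhs t)] --> (0 : R)].

End SquareSummable.

Section Web.
Context {R : realType} {A : countType}.
Implicit Types (L : A -> A -> R) (D E F : set A) (a b : A).

Definition edge L : rel A := [rel a b | (a != b) && (L a b != 0)].

Section Channels.
Context {N : nat}.
Implicit Types (nu : 'I_N -> nat -> A).

Definition channel_part nu : set A := [set a | exists c k, a = nu c k.+1].

Definition core_part nu : set A := ~` channel_part nu.

Record web_like L nu : Prop := WebLike {
  web_sym : forall a b, L a b = L b a ;
  web_selfadjoint : positive_selfadjoint L ;
  web_connected : forall a b, exists p, path (edge L) a p /\ last a p = b ;
  web_tridiagonal : forall c (k n : nat), (1 < `|n - k|)%N ->
    L (nu c k) (nu c n) = 0 ;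
  web_channel : forall c k b,
    edge L (nu c k.+1) b <-> b = nu c k \/ b = nu c k.+2 ;
  web_distinct : forall c d k n, nu c k.+1 = nu d n.+1 -> c = d /\ k = n ;
  web_core_finite : finite_set (core_part nu) ;
  web_core_root : forall c, core_part nu (nu c 0%N) ;
  web_attach : forall a b, core_part nu a -> channel_part nu b ->
    L a b != 0 <-> exists c, a = nu c 0%N /\ b = nu c 1%N ;
  web_free : exists K0 : nat, (0 < K0)%N /\ forall c k, (K0 <= k)%N ->
    - L (nu c k) (nu c k.+1) = 1 /\ L (nu c k) (nu c k) = 2
}.

Definition web_F nu : set A :=
  core_part nu `|` [set a | exists c, a = nu c 1%N].

Definition web_B nu (c0 : 'I_N) : set A :=
  [set a | exists c, c != c0 /\ (a = nu c 0%N \/ a = nu c 1%N)].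

End Channels.

Section Extension.
Variables (L : A -> A -> R) (F : set A).

Definition graph_edge a b : Prop := [/\ F a, F b & edge L a b].

Definition is_extension D D' : Prop :=
  exists b a, [/\ D b,
    unique (fun x => (F `\` D) x /\ graph_edge x b) a & D' = D `|` [set a]].

Inductive extension_chain D : set A -> Prop :=
| chain_refl : extension_chain D D
| chain_step E E' :
    extension_chain D E -> is_extension E E' -> extension_chain D E'.

Definition maximal_chain_end D E : Prop :=
  extension_chain D E /\ ~ exists E', is_extension E E'.

(* The common end of all maximal chains starting at D; it exists and is
   unique for a finite F by the next lemmas. *)
Definition extension_closure D : set A :=
  xget set0 [set E | maximal_chain_end D E].

Lemma maximal_chain_end_exists D :
  finite_set F -> exists E, maximal_chain_end D E.
Proof.
move=> finF.
have [n] : exists n, (#|` fset_set (F `\` D)| <= n)%N by eexists.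
elim: n D => [|n IHn] D leD.
  exists D; split; first exact: chain_refl.
  move=> [_ [b [a [_ [[FDa _] _] _]]]].
  move: leD; rewrite leqn0 cardfs_eq0 => /eqP D0.
  have: a \in fset_set (F `\` D).
    by rewrite in_fset_set ?inE//; exact: finite_setD.
  by rewrite D0 inE.
have [[E' extE']|maxD] := pselect (exists E', is_extension D E'); last first.
  by exists D; split; first exact: chain_refl.
have [b [a [_ [[FDa _] _] E'E]]] := extE'.
have finD E : finite_set (F `\` E) by exact: finite_setD.
have ltE' : (#|` fset_set (F `\` E')| <= n)%N.
  rewrite -ltnS (leq_trans _ leD)//; apply: fproper_ltn_card.
  rewrite fproperE; apply/andP; split.
    apply/fsubsetP => x; rewrite !in_fset_set// !inE E'E => -[Fx nE'x].
    by split=> // Dx; apply: nE'x; left.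
  apply/fsubsetPn; exists a; first by rewrite in_fset_set ?inE.
  by rewrite in_fset_set//; apply/negP; rewrite inE E'E => -[_]; apply; right.
have [E [chE maxE]] := IHn _ ltE'; exists E; split=> //.
elim: chE => [|E1 E2 _ IH ext]; last exact: chain_step ext.
exact: chain_step (chain_refl D) extE'.
Qed.

Lemma maximal_chain_end_unique D E E' :
  maximal_chain_end D E -> maximal_chain_end D E' -> E = E'.
Proof.
have chain_sub X Y : extension_chain X Y -> X `<=` Y.
  by elim=> // Y1 Y2 _ IH [b [a [_ _ ->]]] x /IH; left.
have chain_max X Y Z : extension_chain X Y -> X `<=` Z ->
    ~ (exists Z', is_extension Z Z') -> Y `<=` Z.
  move=> XY XZ maxZ; elim: XY => // Y1 Y2 _ Y1Z.
  move=> [b [a [Y1b [[FY1a ea] ua] ->]]] x [/Y1Z//|->].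
  apply: contrapT => nZa; apply: maxZ; exists (Z `|` [set a]), b, a.
  split; [exact: Y1Z| |by []]; split; first by split=> //; split=> //; case: FY1a.
  move=> y [[Fy nZy] ey]; apply: ua; split=> //; split=> // Y1y.
  by apply: nZy; exact: Y1Z.
move=> [chE maxE] [chE' maxE']; apply/seteqP; split.
  by apply: chain_max chE _ maxE'; exact: chain_sub.
by apply: chain_max chE' _ maxE; exact: chain_sub.
Qed.

Lemma extension_closureE D E :
  maximal_chain_end D E -> extension_closure D = E.
Proof.
move=> DE; apply: maximal_chain_end_unique (DE).
exact: (@xgetPex _ set0 [set E | maximal_chain_end D E] (ex_intro _ E DE)).
Qed.

End Extension.
End Web.

(* Main.v *)
Require Import Defs.
From mathcomp Require Import ring lra.
Set Implicit Arguments.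
Unset Strict Implicit.
Unset Printing Implicit Defensive.
Import Order.TTheory GRing.Theory Num.Theory.
Local Open Scope classical_set_scope.
Local Open Scope complex_scope.
Local Open Scope ring_scope.

(** On the free part of a channel, v_k = u(., nu(K+k)) satisfies
    v_(k-1) = 2 v_k + i v_k' - v_(k+1), so testing v_0 against a polynomial phi
    and integrating by parts in time transfers everything to boundary terms at
    t = 0 and t = 1; the remainder disappears because v_k decays
    superexponentially on all of [0,1].  The decay hypothesis bounds the boundary
    terms by weighted l^1 norms of the Taylor coefficients of phi at 0 and at 1,
    with a radius rho < 1/2.  By Runge's theorem (pole pushing) phi can
    approximate the Poisson kernel e / ((t - t0)^2 + e^2) on [0,1] while these
    norms are O(e), for every t0 in ]rho, 1 - rho[.  Hence v_0 vanishes near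
    t = 1/2.  The equation then propagates the vanishing near t = 1/2 down the
    channels, through the extension procedure to F, and up the channel nu_0, so
    u(1/2) = 0, and uniqueness for bounded solutions of the (sup-norm bounded)
    evolution gives u = 0.  Integrals are replaced by antiderivatives and the mean
    value theorem. *)

(** By Stirling, (e / (beta k))^k is about beta^-k / k!, while the k-th test function is essentially
    the (k-1)-st derivative of [phi], whose value at 0 is at most about k! rho^-k times a weighted
    norm of [phi]. The boundary sums are therefore under control once rho > 1/beta. Since beta = 2 +
    eps exceeds 2, rho can be taken below 1/2, and the discs of radius rho about 0 and 1 are
    disjoint. In the gap between them, the vertical rays starting at the poles t0 + i e and t0 - i e
    of the Poisson kernel escape to infinity without meeting the discs or [0,1]; this is what the
    threshold 2 buys.

    The kernel cannot serve as test function itself: its n-th derivatives near t0 grow like n! /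
    e^n, and at interior times v_n is only shown to decay faster than every geometric sequence. For
    a polynomial the test functions grow geometrically, so the remainder tends to 0. As the
    truncation index n is chosen after [phi], the bounds on the boundary terms must depend neither
    on n nor on the degree of [phi]. *)

Local Notation normc := ComplexField.Normc.normc.

(** * Modulus of complex numbers and weighted coefficient norms of polynomials *)

Section ComplexModulus.
Context {R : realType}.
Implicit Types z w : R[i].

Lemma normc0 : normc (0 : R[i]) = 0.
Proof. exact: ComplexField.Normc.normc0. Qed.

Lemma normc1 : normc (1 : R[i]) = 1.
Proof. exact: ComplexField.Normc.normc1. Qed.

Lemma normcM z w : normc (z * w) = normc z * normc w.
Proof. exact: ComplexField.Normc.normcM. Qed.

Lemma normc_ge0 z : 0 <= normc z.
Proof. by case: z => a b; exact: sqrtr_ge0. Qed.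

Lemma normcD z w : normc (z + w) <= normc z + normc w.
Proof. exact: le_normcD. Qed.

Lemma normc_opp z : normc (- z) = normc z.
Proof. exact: normcN. Qed.

Lemma normcB z w : normc (z - w) <= normc z + normc w.
Proof. by rewrite -(normc_opp w); exact: normcD. Qed.

Lemma normcX z n : normc (z ^+ n) = normc z ^+ n.
Proof.
elim: n => [|n IH]; first by rewrite !expr0 normc1.
by rewrite !exprS normcM IH.
Qed.

Lemma normc_real (x : R) : normc x%:C = `|x|.
Proof. by rewrite /= expr0n addr0 sqrtr_sqr. Qed.

Lemma normc_nat n : normc (n%:R : R[i]) = n%:R.
Proof. by rewrite -(rmorph_nat (@real_complex R)) normc_real normr_nat. Qed.

Lemma normc_i : normc ('i%C : R[i]) = 1.
Proof. by rewrite /= expr0n add0r expr1n sqrtr1. Qed.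

Lemma normc_ge_normRe z : `|complex.Re z| <= normc z.
Proof.
case: z => a b /=; rewrite -sqrtr_sqr ler_wsqrtr//.
by rewrite lerDl sqr_ge0.
Qed.

Lemma normc_ge_normIm z : `|complex.Im z| <= normc z.
Proof.
case: z => a b /=; rewrite -sqrtr_sqr ler_wsqrtr//.
by rewrite lerDr sqr_ge0.
Qed.

Lemma normc_le_ReIm z : normc z <= `|complex.Re z| + `|complex.Im z|.
Proof.
case: z => a b /=.
rewrite -(ger0_norm (addr_ge0 (normr_ge0 a) (normr_ge0 b))) -sqrtr_sqr.
rewrite ler_wsqrtr// sqrrD !real_normK ?num_real// -addrA lerD2l lerDr.
by rewrite mulrn_wge0// mulr_ge0.
Qed.

Lemma normc_sum (I : Type) (s : seq I) (P : pred I) (F : I -> R[i]) :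
  normc (\sum_(i <- s | P i) F i) <= \sum_(i <- s | P i) normc (F i).
Proof.
elim/big_ind2 : _ => //; first by rewrite normc0.
by move=> x x' y y' hx hy; rewrite (le_trans (normcD _ _))// lerD.
Qed.

End ComplexModulus.

Local Arguments ComplexField.Normc.normc : simpl never.

Section WeightedNorm.
Context {R : realType}.
Implicit Types (p q : {poly R[i]}) (r : R).

(** The l^1 norm of the Taylor coefficients at 0 on the disc of radius [r]. It is submultiplicative
    and bounds each derivative at 0; precomposing with ['X + 1%:P] gives the same norm at 1. *)
Definition wnorm r p : R := \sum_(i < size p) normc p`_i * r ^+ i.

Lemma wnorm_widen r p n : (size p <= n)%N ->
  wnorm r p = \sum_(i < n) normc p`_i * r ^+ i.
Proof.
move=> pn; rewrite /wnorm (big_ord_widen n (fun i => normc p`_i * r ^+ i))//.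
rewrite big_mkcond; apply: eq_bigr => i _; case: ltnP => // /(nth_default 0) ->.
by rewrite normc0 mul0r.
Qed.

Lemma wnorm_ge0 r p : 0 <= r -> 0 <= wnorm r p.
Proof. by move=> r0; apply: sumr_ge0 => i _; rewrite mulr_ge0 ?normc_ge0 ?exprn_ge0. Qed.

Lemma wnormD r p q : 0 <= r -> wnorm r (p + q) <= wnorm r p + wnorm r q.
Proof.
move=> r0; set n := maxn (size p) (size q).
rewrite (@wnorm_widen r (p + q) n) ?size_polyD//.
rewrite (@wnorm_widen r p n) ?leq_maxl// (@wnorm_widen r q n) ?leq_maxr//.
rewrite -big_split/=; apply: ler_sum => i _.
by rewrite coefD -mulrDl ler_wpM2r ?exprn_ge0 ?normcD.
Qed.

Lemma wnormC_mul r c p : wnorm r (c%:P * p) = normc c * wnorm r p.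
Proof.
rewrite (@wnorm_widen r (c%:P * p) (size p)); last first.
  by rewrite mul_polyC size_scale_leq.
rewrite mulr_sumr; apply: eq_bigr => i _.
by rewrite coefCM normcM mulrA.
Qed.

Lemma wnorm_mulX r p : wnorm r (p * 'X) = r * wnorm r p.
Proof.
rewrite (@wnorm_widen r (p * 'X) (size p).+1); last first.
  by rewrite (leq_trans (size_polyMleq _ _))// size_polyX addn2.
rewrite big_ord_recl coefMX/= normc0 mul0r add0r.
rewrite mulr_sumr; apply: eq_bigr => i _.
by rewrite coefMX/= exprS; ring.
Qed.

Lemma wnormC r c : wnorm r c%:P = normc c.
Proof.
rewrite (@wnorm_widen r _ 1) ?size_polyC_leq1//.
by rewrite big_ord1 coefC/= mulr1.
Qed.

Lemma wnormM r p q : 0 <= r -> wnorm r (p * q) <= wnorm r p * wnorm r q.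
Proof.
move=> r0; elim/poly_ind : p => [|p c IH].
  by rewrite mul0r -[0]/(0%:P) wnormC normc0 mul0r.
have -> : wnorm r (p * 'X + c%:P) = r * wnorm r p + normc c.
  rewrite (@wnorm_widen r _ (size p).+1); last first.
    rewrite (leq_trans (size_polyD _ _))// geq_max (leq_trans (size_polyMleq _ _)) ?size_polyX ?addn2//.
    by rewrite (leq_trans (size_polyC_leq1 _)).
  rewrite big_ord_recl coefD coefMX coefC/= add0r mulr1 addrC; congr (_ + _).
  rewrite mulr_sumr; apply: eq_bigr => i _.
  by rewrite coefD coefMX coefC/= addr0 exprS; ring.
rewrite mulrDl (le_trans (wnormD _ _ r0))// wnormC_mul mulrDl lerD2r.
by rewrite mulrAC wnorm_mulX -mulrA ler_wpM2l.
Qed.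

Lemma normc_coef_le_wnorm r p i : 0 <= r -> normc p`_i * r ^+ i <= wnorm r p.
Proof.
move=> r0; rewrite (@wnorm_widen r p (maxn (size p) i.+1)) ?leq_maxl//.
have hi : (i < maxn (size p) i.+1)%N by rewrite leq_max ltnSn orbT.
rewrite (bigD1 (Ordinal hi))//= lerDl; apply: sumr_ge0 => j _.
by rewrite mulr_ge0 ?normc_ge0 ?exprn_ge0.
Qed.

Lemma normc_horner_le_wnorm p (t : R) : 0 <= t <= 1 ->
  normc p.[t%:C] <= wnorm 1 p.
Proof.
move=> /andP[t0 t1]; rewrite horner_coef (le_trans (normc_sum _ _ _))//.
apply: ler_sum => i _; rewrite normcM ler_wpM2l ?normc_ge0//.
by rewrite normcX normc_real expr1n exprn_ile1// ger0_norm.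
Qed.

End WeightedNorm.

(** * Test functions generated by the transposed recursion *)

Section PoleChain.
Context {R : realType}.
Implicit Types (p q : {poly R[i]}) (r : R).

(* With v_k' = i (2 v_k - v_(k-1) - v_(k+1)), the transposed recursion on
   test functions. *)
Fixpoint tchain p n : {poly R[i]} := match n with
  | 0 => 0
  | 1 => p
  | (m.+1 as k).+1 => 2%:P * tchain p k - 'i%C%:P * (tchain p k)^`() - tchain p m
  end.

Lemma tchainSS p n : tchain p n.+2 =
  2%:P * tchain p n.+1 - 'i%C%:P * (tchain p n.+1)^`() - tchain p n.
Proof. by []. Qed.

Lemma tchain_shift p c n :
  tchain (p \Po ('X + c%:P)) n = tchain p n \Po ('X + c%:P).
Proof.
suff : tchain (p \Po ('X + c%:P)) n = tchain p n \Po ('X + c%:P) /\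
  tchain (p \Po ('X + c%:P)) n.+1 = tchain p n.+1 \Po ('X + c%:P) by case.
elim: n => [|n [IH0 IH1]]; first by rewrite /= comp_poly0.
split=> //; rewrite !tchainSS IH0 IH1 deriv_comp derivD derivX derivC addr0 mulr1.
by rewrite !rmorphB !rmorphM/= !comp_polyC.
Qed.

Lemma size_tchain p n : (size (tchain p n) <= size p)%N.
Proof.
suff : (size (tchain p n) <= size p)%N /\ (size (tchain p n.+1) <= size p)%N by case.
elim: n => [|n [IH0 IH1]]; first by rewrite /= size_poly0.
split=> //; rewrite tchainSS.
rewrite (leq_trans (size_polyD _ _))// geq_max size_polyN IH0 andbT.
rewrite (leq_trans (size_polyD _ _))// geq_max size_polyN !mul_polyC.
rewrite !(leq_trans (size_scale_leq _ _))//.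
by rewrite (leq_trans (leq_trans (size_poly _ _) (leq_pred _)) IH1).
Qed.

Lemma wnorm1_deriv p : wnorm 1 p^`() <= (size p)%:R * wnorm 1 p.
Proof.
rewrite (@wnorm_widen _ 1 p^`() (size p)); last first.
  by rewrite (leq_trans (size_poly _ _) (leq_pred _)).
rewrite (@wnorm_widen _ 1 p (size p).+1)// big_ord_recl mulrDr.
rewrite ler_wpDl ?mulr_ge0 ?normc_ge0 ?exprn_ge0//.
rewrite mulr_sumr; apply: ler_sum => i _.
rewrite coef_deriv -[X in normc X]mulr_natr normcM normc_nat !expr1n !mulr1.
rewrite mulrC ler_wpM2r ?normc_ge0// ler_nat; exact: ltn_ord.
Qed.

(** For fixed [p] every derivative costs at most the factor [size p], since the recursion never
    raises the degree; the three terms of the recursion then give 2 + [size p] + 1. This crude bound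
    depends on the degree and serves only for the remainder, which is killed by the decay of [v]. *)
Lemma tchain_growth p n :
  wnorm 1 (tchain p n) <= ((size p)%:R + 3) ^+ n * wnorm 1 p.
Proof.
have w0 := @wnorm_ge0 R 1 _ ler01.
set A := (size p)%:R + 3; have A3 : 3 <= A by rewrite /A lerDr.
suff : wnorm 1 (tchain p n) <= A ^+ n * wnorm 1 p /\
  wnorm 1 (tchain p n.+1) <= A ^+ n.+1 * wnorm 1 p by case.
elim: n => [|n [IH0 IH1]].
  rewrite /= expr0 expr1 mul1r -[0]/(0%:P) wnormC normc0; split=> //.
  by rewrite ler_peMl//; lra.
split=> //; rewrite tchainSS.
have wN q : wnorm 1 (- q) = wnorm 1 q.
  by rewrite -mulN1r -[-1]polyCN wnormC_mul normc_opp normc1 mul1r.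
apply: (le_trans (wnormD _ _ ler01)); rewrite wN.
apply: (@le_trans _ _ (2 * wnorm 1 (tchain p n.+1) + (size p)%:R * wnorm 1 (tchain p n.+1)
   + wnorm 1 (tchain p n))).
  rewrite lerD2r (le_trans (wnormD _ _ ler01))// wN !wnormC_mul normc_nat normc_i mul1r.
  rewrite lerD2l (le_trans (wnorm1_deriv _))// ler_wpM2r// ler_nat; exact: size_tchain.
have IH2 : wnorm 1 (tchain p n) <= A ^+ n.+1 * wnorm 1 p.
  rewrite (le_trans IH0)// ler_wpM2r// ler_eXn2l//; lra.
have sz0 : 0 <= (size p)%:R :> R by [].
rewrite exprS -mulrA.
move: IH1 IH2 (w0 (tchain p n.+1)) (w0 (tchain p n)); rewrite /A.
set X := _ ^+ n.+1 * _; set a := wnorm 1 _; set b := wnorm 1 _ => h1 h2 h3 h4.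
rewrite !mulrDl -addrA; have := ler_wpM2l sz0 h1; lra.
Qed.

(** The leading part of [tchain p n.+1] is the n-th derivative of [p] up to a unit, whose m-th
    coefficient times m! is (n + m)! times a coefficient of [p]. The two lower-order terms of the
    recursion are absorbed by the factor [th] per step: with [s] the growth of the bound from m to m
    + 1, the induction needs 3 + s <= th s. The shift [q] in the factorial makes this true from the
    first step on. The bound does not involve the degree. *)
Lemma tchain_coef_le (r th : R) (q : nat) p n m : 1 <= r -> 1 < th ->
  3 <= (th - 1) * q.+1%:R ->
  normc (tchain p n.+1)`_m * m`!%:R <=
  th ^+ n * (n + m + q)`!%:R * r ^+ (n + m) * wnorm r^-1 p.
Proof.
move=> r1 th1 hq.
have r0 : 0 < r by lra.
have th0 : 0 < th by lra.
have w0 : 0 <= wnorm r^-1 p by rewrite wnorm_ge0// invr_ge0 ltW.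
set B := fun n m => th ^+ n * (n + m + q)`!%:R * r ^+ (n + m) * wnorm r^-1 p.
have B0 k l : 0 <= B k l by rewrite /B !mulr_ge0 ?exprn_ge0 ?(ltW r0) ?(ltW th0).
have B1 k l : B k.+1 l = th * B k l * ((k + l + q).+1%:R * r).
  rewrite /B !addSn factS natrM !exprS;
  move: (_%:R) (_%:R) (_ ^+ _) (_ ^+ _) => x1 x2 x3 x4; ring.
have B2 k l : B k l.+1 = B k l * ((k + l + q).+1%:R * r).
  rewrite /B addnS addSn factS natrM !exprS;
  move: (_%:R) (_%:R) (_ ^+ _) (_ ^+ _) => x1 x2 x3 x4; ring.
suff H : forall k l, normc (tchain p k.+1)`_l * l`!%:R <= B k l /\
                normc (tchain p k.+2)`_l * l`!%:R <= B k.+1 l by case: (H n m).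
have step k : (forall l, normc (tchain p k.+1)`_l * l`!%:R <= B k l) ->
    (forall l, normc (tchain p k)`_l * l`!%:R <= B k l) ->
    forall l, normc (tchain p k.+2)`_l * l`!%:R <= B k.+1 l.
  move=> IH1 IH0 l.
  apply: (@le_trans _ _ (2 * B k l + B k l.+1 + B k l)).
    rewrite tchainSS !coefB !coefCM coef_deriv.
    apply: (le_trans (ler_wpM2r (ler0n _ _) (normcB _ _))).
    rewrite mulrDl lerD//.
    apply: (le_trans (ler_wpM2r (ler0n _ _) (normcB _ _))).
    rewrite mulrDl lerD//.
      by rewrite normcM normc_nat -mulrA ler_wpM2l.
    rewrite normcM normc_i mul1r -[X in normc X]mulr_natr normcM normc_nat.
    by rewrite -mulrA -natrM -factS.
  rewrite B1 B2.
  set s := (k + l + q).+1%:R * r.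
  have hs : 3 <= (th - 1) * s.
    rewrite (le_trans hq)// ler_wpM2l//; first lra.
    rewrite (@le_trans _ _ ((k + l + q).+1%:R))//; first by rewrite ler_nat ltnS leq_addl.
    by rewrite /s ler_peMr.
  have := ler_wpM2r (B0 k l) hs.
  nra.
elim=> [|k IH] l.
  have base l' : normc (tchain p 1)`_l' * l'`!%:R <= B 0%N l'.
    rewrite /B/= expr0 mul1r add0n.
    have := normc_coef_le_wnorm p l' (ltW (_ : 0 < r^-1)).
    rewrite invr_gt0 => /(_ r0) h.
    rewrite exprVn ler_pdivrMr ?exprn_gt0// in h.
    rewrite mulrC -mulrA ler_pM ?normc_ge0//; last by rewrite mulrC.
    rewrite ler_nat; apply: leq_fact; apply: leq_addr.
  split=> //; apply: step => // l'.
  by rewrite /= coef0 normc0 mul0r.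
split; first by case: (IH l).
apply: step => l'; first by case: (IH l').
apply: (le_trans (proj1 (IH l'))).
rewrite B1 -mulrA mulrCA ler_peMr//.
have : 1 <= (k + l' + q).+1%:R * r.
  by rewrite (le_trans r1)// ler_peMl ?ler1n// ltW.
nra.
Qed.

End PoleChain.

(** * Runge approximation by pole pushing *)

Section PolynomialApproximation.
Context {R : realType}.
Implicit Types (p q : {poly R[i]}) (z w : R[i]).

Record poly_seminorm (N : {poly R[i]} -> R) : Prop := PolySeminorm {
  pnorm_ge0 : forall p, 0 <= N p ;
  pnormD : forall p q, N (p + q) <= N p + N q ;
  pnormM : forall p q, N (p * q) <= N p * N q ;
  pnormC : forall c, N c%:P = normc c }.

Section SeminormTheory.
Variables (N : {poly R[i]} -> R) (hN : poly_seminorm N).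

Lemma pnormC_mul c p : N (c%:P * p) <= normc c * N p.
Proof. by rewrite -(pnormC hN); exact: (pnormM hN). Qed.

Lemma pnormN p : N (- p) = N p.
Proof.
have le q : N (- q) <= N q.
  by rewrite -mulN1r -[-1]polyCN (le_trans (pnormC_mul _ _))// normc_opp normc1 mul1r.
by apply/eqP; rewrite eq_le le/= -{1}(opprK p) le.
Qed.

Lemma pnormB p q : N (p - q) <= N p + N q.
Proof. by rewrite -(pnormN q); exact: (pnormD hN). Qed.

Lemma pnormX p n : N (p ^+ n) <= N p ^+ n.
Proof.
elim: n => [|n IH]; first by rewrite !expr0 -[1]/(1%:P) (pnormC hN) normc1.
by rewrite !exprS (le_trans (pnormM hN _ _))// ler_wpM2l// (pnorm_ge0 hN).
Qed.

End SeminormTheory.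

(** This says that 1 / (x - z) is a limit of polynomials uniformly over the seminorms in [F].
    Multiplying by x - z keeps everything inside polynomials, where the seminorms are defined. *)
Definition approx_pole (F : set ({poly R[i]} -> R)) z := forall eta : R, 0 < eta ->
  exists p, forall N, F N -> N (1 - ('X - z%:P) * p) <= eta.

Variable F : set ({poly R[i]} -> R).
Hypothesis hF : forall N, F N -> poly_seminorm N.

(* Neumann series *)
Lemma approx_pole_lt1 z p (x : R) : 0 <= x < 1 ->
  (forall N, F N -> N (1 - ('X - z%:P) * p) <= x) -> approx_pole F z.
Proof.
move=> /andP[x0 x1] hp eta eta0.
have : x ^+ n @[n --> \oo] --> (0 : R) by apply: cvg_expr; rewrite ger0_norm.
move=> /cvgrPdist_le/(_ _ eta0) [n _ /(_ n (leqnn n))].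
rewrite sub0r normrN ger0_norm ?exprn_ge0// => hn.
set s := 1 - ('X - z%:P) * p in hp.
exists (p * \sum_(i < n) s ^+ i) => N FN.
have -> : 1 - ('X - z%:P) * (p * \sum_(i < n) s ^+ i) = s ^+ n.
  have -> : ('X - z%:P) * (p * \sum_(i < n) s ^+ i) =
      - ((s - 1) * \sum_(i < n) s ^+ i) by rewrite /s; ring.
  by rewrite -subrX1; ring.
rewrite (le_trans (pnormX (hF FN) _ _))// (le_trans _ hn)//.
by rewrite lerXn2r ?nnegrE ?(pnorm_ge0 (hF FN)) ?hp.
Qed.

(** The constant -1/z is the first term of the geometric expansion of 1 / (x - z) in powers of x /
    z, which converges because |x| <= m < |z|. This starts the pole pushing. *)
Lemma approx_pole_far z (m : R) : 0 <= m < normc z ->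
  (forall N, F N -> N 'X <= m) -> approx_pole F z.
Proof.
move=> /andP[m0 mz] hX.
have z0 : 0 < normc z by exact: le_lt_trans mz.
have zn0 : z != 0 by apply: contraTneq z0 => ->; rewrite normc0 ltxx.
apply: (@approx_pole_lt1 z (- z^-1)%:P (m / normc z)).
  by apply/andP; split; [rewrite divr_ge0// ltW|rewrite ltr_pdivrMr// mul1r].
move=> N FN.
have -> : 1 - ('X - z%:P) * (- z^-1)%:P = (z^-1)%:P * 'X.
  rewrite polyCN mulrN opprK mulrBl -[z%:P * _]polyCM divff//.
  by rewrite addrC subrK mulrC.
rewrite (le_trans (pnormC_mul (hF FN) _ _))// ComplexField.Normc.normcV mulrC.
by rewrite ler_wpM2r ?invr_ge0 ?normc_ge0 ?hX.
Qed.

(** An approximate inverse [p] of X - w has norm about 1/d at most, by the lower bound on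
    multiplication by X - w. Used as an inverse of X - z, it adds the error (z - w) p, of size about
    |z - w| / d < 1, and the Neumann series repairs an error below 1. *)
Lemma approx_pole_push w z (d : R) : 0 < d -> approx_pole F w ->
  (forall N p, F N -> d * N p <= N (('X - w%:P) * p)) ->
  normc (z - w) < d -> approx_pole F z.
Proof.
move=> d0 hw hd zw.
have nzw := normc_ge0 (z - w).
set y := normc (z - w) / d.
have y0 : 0 <= y by rewrite divr_ge0// ltW.
have y1 : y < 1 by rewrite ltr_pdivrMr// mul1r.
(* With this accuracy the total error is at most (1 - y)/4 + y (1 + (1 - y)/4) <= (1 + y)/2 < 1. *)
have [|p hp] := hw ((1 - y) / 4); first lra.
apply: (@approx_pole_lt1 z p ((1 + y) / 2 )); first by apply/andP; split; lra.
move=> N FN.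
have -> : 1 - ('X - z%:P) * p = (1 - ('X - w%:P) * p) + (z - w)%:P * p.
  by rewrite polyCB; ring.
rewrite (le_trans (pnormD (hF FN) _ _))//.
have h1 := hp N FN.
have h2 := hd N p FN.
have h3 : N (('X - w%:P) * p) <= 1 + (1 - y) / 4.
  have -> : ('X - w%:P) * p = 1 - (1 - ('X - w%:P) * p) by ring.
  rewrite (le_trans (pnormB (hF FN) _ _))// -[1]/(1%:P) (pnormC (hF FN)) normc1.
  by rewrite lerD2l.
have h4 := pnormC_mul (hF FN) (z - w) p.
have h5 : normc (z - w) * N p <= y * (1 + (1 - y) / 4).
  have -> : normc (z - w) = y * d by rewrite /y divfK// gt_eqF.
  by rewrite -mulrA ler_wpM2l// (le_trans h2).
have y2 : 0 <= y ^+ 2 by exact: sqr_ge0.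
have := le_trans h4 h5; nra.
Qed.

(** The curve [w] comes from infinity. The lower bound [Num.min y d] only improves farther out, so
    its value at the target height fixes one step length [h] valid all along, and finitely many
    pushes come down from a point beyond [m]. *)
Lemma approx_pole_ray (w : R -> R[i]) (m d : R) : 0 < d -> 0 <= m ->
  (forall N, F N -> N 'X <= m) ->
  (forall y, y <= normc (w y)) ->
  (forall y y', normc (w y - w y') <= `|y - y'|) ->
  (forall y N p, 0 < y -> F N ->
     Num.min y d * N p <= N (('X - (w y)%:P) * p)) ->
  forall y, 0 < y -> approx_pole F (w y).
Proof.
move=> d0 m0 hX wfar wlip hlow y y0.
set h := Num.min y d / 2.
have min0 : 0 < Num.min y d by rewrite lt_min y0.
have h0 : 0 < h by rewrite /h; lra.
have H n : approx_pole F (w (y + n%:R * h)) -> approx_pole F (w y).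
  elim: n => [|n IH]; first by rewrite mul0r addr0.
  move=> hn; apply: IH.
  have yn : y <= y + n.+1%:R * h by rewrite lerDl mulr_ge0// ltW.
  apply: (approx_pole_push (d := Num.min (y + n.+1%:R * h) d)) hn _ _.
  - by rewrite lt_min d0 (lt_le_trans y0 yn).
  - by move=> N p FN; apply: hlow => //; exact: lt_le_trans yn.
  - apply: le_lt_trans (wlip _ _) _.
    rewrite (_ : _ - _ = - h); last by rewrite -natr1; ring.
    rewrite normrN gtr0_norm//; apply: (@lt_le_trans _ _ (Num.min y d)).
      by rewrite /h; lra.
    by rewrite le_min !ge_min yn lexx orbT.
pose n := Num.bound (m / h).
apply: (H n); apply: (@approx_pole_far _ m) => //.
rewrite m0/= (lt_le_trans _ (wfar _))//.
have : m / h < n%:R by rewrite archi_boundP// divr_ge0// ltW.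
by rewrite ltr_pdivrMr// => hm; lra.
Qed.

End PolynomialApproximation.

(** * Approximation of the Poisson kernel on [0,1] and on the two discs *)

Section PoissonApproximation.
Context {R : realType}.
Implicit Types (p q : {poly R[i]}) (z w : R[i]).

Lemma poly_seminorm_wnorm (rho : R) : 0 <= rho -> poly_seminorm (wnorm rho).
Proof.
move=> r0; split=> *; [exact: wnorm_ge0|exact: wnormD|exact: wnormM|exact: wnormC].
Qed.

Lemma poly_seminorm_wnorm_shift (rho : R) : 0 <= rho ->
  poly_seminorm (fun p => wnorm rho (p \Po ('X + 1%:P))).
Proof.
move=> r0; split=> *; first exact: wnorm_ge0.
- by rewrite rmorphD/=; exact: wnormD.
- by rewrite rmorphM/=; exact: wnormM.
- by rewrite comp_polyC wnormC.
Qed.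

Lemma poly_seminorm_eval (x : R[i]) : poly_seminorm (fun p => normc p.[x]).
Proof.
split=> *; first exact: normc_ge0.
- by rewrite hornerD; exact: normcD.
- by rewrite hornerM normcM.
- by rewrite hornerC.
Qed.

(** Reverse triangle inequality: multiplication by w scales the norm by |w|, multiplication by X
    scales it by [rho]. So |w| - [rho], the distance from the pole to the disc, is the lower
    bound. *)
Lemma wnormXsub_ge (rho : R) w p : 0 <= rho ->
  (normc w - rho) * wnorm rho p <= wnorm rho (('X - w%:P) * p).
Proof.
move=> r0; rewrite mulrBl -wnorm_mulX lerBlDr -wnormC_mul.
have -> : w%:P * p = - (('X - w%:P) * p) + p * 'X by ring.
rewrite (le_trans (wnormD _ _ r0))//.
by rewrite (pnormN (poly_seminorm_wnorm r0)).
Qed.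

Variables (rho t0 : R).
Hypotheses (rho0 : 0 < rho) (rho_t0 : rho < t0) (rho_t1 : rho < 1 - t0).

Definition interval_norms : set ({poly R[i]} -> R) := [set N |
  [\/ N = wnorm rho, N = (fun p => wnorm rho (p \Po ('X + 1%:P))) |
   exists2 t : R, 0 <= t <= 1 & N = (fun p => normc p.[t%:C])]].

Lemma interval_norms_seminorm N : interval_norms N -> poly_seminorm N.
Proof.
have r0 := ltW rho0.
move=> [->|->|[t _ ->]];
  [exact: poly_seminorm_wnorm|exact: poly_seminorm_wnorm_shift|exact: poly_seminorm_eval].
Qed.

Lemma interval_normsX N : interval_norms N -> N 'X <= 2.
Proof.
have [r0 r1] : 0 < rho /\ rho <= 1 by split; move: rho0 rho_t0 rho_t1; lra.
have wX : wnorm rho 'X = rho.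
  by rewrite -[in LHS](mul1r 'X) wnorm_mulX -[1]/(1%:P) wnormC normc1 mulr1.
move=> [->|->|[t t01 ->]].
- by rewrite wX; lra.
- rewrite comp_polyX (le_trans (wnormD _ _ (ltW rho0)))// wX wnormC normc1; lra.
- by rewrite hornerX normc_real ler_norml; move/andP: t01 => [? ?]; apply/andP; split; lra.
Qed.

(** Distance from the line Re z = [t0] to the nearer of the discs of radius [rho] about 0 and 1. *)
Let d := Num.min t0 (1 - t0) - rho.

Lemma wnorm_Xsub_ge (z : R[i]) p : complex.Re z = t0 ->
  d * wnorm rho p <= wnorm rho (('X - z%:P) * p).
Proof.
move=> zt0; rewrite (le_trans _ (wnormXsub_ge _ _ (ltW rho0)))//.
rewrite ler_wpM2r ?(wnorm_ge0 _ (ltW rho0))// lerD2r ge_min.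
by rewrite (le_trans _ (normc_ge_normRe z))// zt0 ler_norm.
Qed.

Lemma wnorm_shift_Xsub_ge (z : R[i]) p : complex.Re z = t0 ->
  d * wnorm rho (p \Po ('X + 1%:P)) <=
  wnorm rho ((('X - z%:P) * p) \Po ('X + 1%:P)).
Proof.
move=> zt0; rewrite rmorphM rmorphB/= comp_polyX comp_polyC.
have -> : 'X + 1%:P - z%:P = 'X - (z - 1)%:P by rewrite polyCB; ring.
rewrite (le_trans _ (wnormXsub_ge _ _ (ltW rho0)))//.
rewrite ler_wpM2r ?(wnorm_ge0 _ (ltW rho0))// lerD2r ge_min; apply/orP; right.
apply: le_trans (normc_ge_normRe (z - 1)).
rewrite (_ : complex.Re (z - 1) = t0 - 1); last by rewrite -zt0; case: (z).
by rewrite -normrN ler_normr; apply/orP; left; lra.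
Qed.

(** The disc norms see the distance [d] at every height of the pole, whereas a real point t may lie
    directly below it and sees only |Im z|; hence the minimum. *)
Lemma interval_norms_lower (z : R[i]) N p : complex.Re z = t0 -> interval_norms N ->
  Num.min `|complex.Im z| d * N p <= N (('X - z%:P) * p).
Proof.
move=> zt0 FN; have N0 := pnorm_ge0 (interval_norms_seminorm FN) p.
have md : Num.min `|complex.Im z| d <= d by rewrite ge_min lexx orbT.
case: FN N0 => [->|->|[t t01 ->]] N0.
- exact: le_trans (ler_wpM2r N0 md) (wnorm_Xsub_ge _ zt0).
- exact: le_trans (ler_wpM2r N0 md) (wnorm_shift_Xsub_ge _ zt0).
- rewrite hornerM normcM ler_wpM2r// !hornerE ge_min.
  rewrite (le_trans _ (normc_ge_normIm _))//.
  by case: (z) => a b /=; rewrite sub0r normrN.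
Qed.

Lemma approx_pole_vertical (s : bool) (y : R) : 0 < y ->
  approx_pole interval_norms (t0 +i* ((-1) ^+ s * y)).
Proof.
move: y; apply: (@approx_pole_ray _ _ _ (fun y => t0 +i* ((-1) ^+ s * y)) 2 d) => //.
- exact: interval_norms_seminorm.
- by rewrite subr_gt0 lt_min rho_t0.
- exact: interval_normsX.
- move=> y; rewrite (le_trans _ (normc_ge_normIm _))//=.
  by rewrite normrM normrX normrN1 expr1n mul1r ler_norm.
- move=> y y'; rewrite (le_trans (normc_le_ReIm _))//= subrr normr0 add0r.
  by rewrite -mulrBr normrM normrX normrN1 expr1n mul1r.
- move=> y N p y0 FN; have := interval_norms_lower p (_ : complex.Re (t0 +i* ((-1) ^+ s * y)) = t0) FN.
  by rewrite /= normrM normrX normrN1 expr1n mul1r gtr0_norm//; apply.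
Qed.

(** The kernel is (1/(t - z) - 1/(t - z')) / (2i) with z, z' = t0 + i e, t0 - i e. Hence (X - z)(X -
    z') [phi] is nearly the constant [e] in all the norms. On the discs both factors can be divided
    out at the cost of 1/d^2, which gives a bound linear in [e] with [K] independent of [e]. *)
Lemma poisson_kernel_approx : exists2 K : R, 0 < K & forall e : R, 0 < e <= 1 ->
  exists phi : {poly R[i]}, [/\ wnorm rho phi <= K * e,
    wnorm rho (phi \Po ('X + 1%:P)) <= K * e &
    forall t : R, 0 <= t <= 1 ->
      normc (phi.[t%:C] - (e / ((t - t0) ^+ 2 + e ^+ 2))%:C) <= e].
Proof.
have d0 : 0 < d by rewrite subr_gt0 lt_min rho_t0.
have [r0 r1] : 0 < rho /\ rho <= 1 by split; move: rho0 rho_t0 rho_t1; lra.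
have [t00 t0lt1] : 0 < t0 /\ t0 < 1 by split; move: rho0 rho_t0 rho_t1; lra.
exists (2 / d ^+ 2); first by rewrite divr_gt0 ?exprn_gt0.
move=> e /andP[e0 e1].
(* On [0,1] the product (t - z)(t - z') may be as small as e^2, so it takes an error e^3 in [q] to
   get an error e in [phi]. Each pole contributes half of it: 4 from the other linear factor, 1/2
   from [c]. *)
have eta0 : 0 < e ^+ 3 / 4 by rewrite divr_gt0 ?exprn_gt0.
have [p1 hp1] := approx_pole_vertical false e0 eta0.
have [p2 hp2] := approx_pole_vertical true e0 eta0.
move: hp1 hp2; rewrite expr0 mul1r expr1 mulN1r => hp1 hp2.
set z := t0 +i* e in hp1; set z' := t0 +i* - e in hp2.
pose c : R[i] := (2 * 'i%C)^-1.
have c0 : 2 * 'i%C != 0 :> R[i].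
  by rewrite mulf_neq0 ?pnatr_eq0// eq_complex/= oner_eq0 andbF.
have nc : normc c = 2^-1.
  by rewrite ComplexField.Normc.normcV normcM normc_nat normc_i mulr1.
have zz' : c * (z - z') = e%:C.
  apply: (mulfI c0); rewrite /c mulrA mulfV// mul1r /z /z'.
  apply/eqP; rewrite eq_complex /=; apply/andP; split; apply/eqP; ring.
pose phi := c%:P * (p1 - p2); exists phi.
pose q := ('X - z%:P) * (('X - z'%:P) * phi).
have qE : q = e%:C%:P - c%:P * ((('X - z'%:P)) * (1 - ('X - z%:P) * p1)) +
               c%:P * (('X - z%:P) * (1 - ('X - z'%:P) * p2)).
  by rewrite -zz' polyCM polyCB /q /phi; ring.
have nz : normc z <= 2.
  rewrite (le_trans (normc_le_ReIm _))//= !ger0_norm; lra.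
have nz' : normc z' <= 2.
  rewrite (le_trans (normc_le_ReIm _))//= normrN !ger0_norm; lra.
have hq N : interval_norms N -> N (q - e%:C%:P) <= e ^+ 3.
  move=> FN; have sN := interval_norms_seminorm FN.
  have hz x : normc x <= 2 -> N ('X - x%:P) <= 4.
    move=> hx; rewrite (le_trans (pnormB sN _ _))// (pnormC sN).
    by have := interval_normsX FN; lra.
  have hh x y p : normc x <= 2 -> N (1 - ('X - y%:P) * p) <= e ^+ 3 / 4 ->
      N (c%:P * (('X - x%:P) * (1 - ('X - y%:P) * p))) <= e ^+ 3 / 2.
    move=> hx hp; rewrite (le_trans (pnormC_mul sN _ _))// nc.
    rewrite mulrC ler_pdivlMr// -mulrA mulVf ?pnatr_eq0// mulr1.
    rewrite (le_trans (pnormM sN _ _))//.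
    have := ler_pM (pnorm_ge0 sN _) (pnorm_ge0 sN _) (hz _ hx) hp; lra.
  have -> : q - e%:C%:P = - (c%:P * ((('X - z'%:P)) * (1 - ('X - z%:P) * p1))) +
               c%:P * (('X - z%:P) * (1 - ('X - z'%:P) * p2)) by rewrite qE; ring.
  rewrite (le_trans (pnormD sN _ _))// (pnormN sN).
  have := lerD (hh z' z p1 nz' (hp1 _ FN)) (hh z z' p2 nz (hp2 _ FN)); lra.
have e3 : e ^+ 3 <= e by rewrite -[leRHS]expr1 ler_wiXn2l// ltW.
have hw N : interval_norms N -> (forall x p, complex.Re x = t0 -> d * N p <= N (('X - x%:P) * p)) ->
    N phi <= 2 / d ^+ 2 * e.
  move=> FN hN; have sN := interval_norms_seminorm FN.
  have h : d ^+ 2 * N phi <= N q.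
    rewrite expr2 -mulrA (le_trans (ler_wpM2l (ltW d0) (hN z' phi erefl)))//.
    exact: hN.
  rewrite mulrAC ler_pdivlMr ?exprn_gt0// mulrC (le_trans h)//.
  have -> : q = (q - e%:C%:P) + e%:C%:P by ring.
  rewrite (le_trans (pnormD sN _ _))// (pnormC sN) normc_real gtr0_norm//.
  by have := hq N FN; lra.
split.
- by apply: hw => [|x p]; [constructor 1|exact: wnorm_Xsub_ge].
- apply: (hw (fun p => wnorm rho (p \Po ('X + 1%:P)))) => [|x p].
    by constructor 2.
  exact: wnorm_shift_Xsub_ge.
- move=> t t01.
  have FN : interval_norms (fun p => normc p.[t%:C]) by constructor 3; exists t.
  have := hq _ FN; rewrite /=.
  set P := (t - t0) ^+ 2 + e ^+ 2.
  have P0 : 0 < P by rewrite /P ltr_wpDl ?sqr_ge0 ?exprn_gt0.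
  have -> : (q - e%:C%:P).[t%:C] = P%:C * (phi.[t%:C] - (e / P)%:C).
    rewrite mulrBr -rmorphM/= [P * _]mulrC divfK ?gt_eqF// hornerD hornerN hornerC.
    congr (_ - _); rewrite /q hornerM hornerM !hornerXsubC mulrA; congr (_ * _).
    rewrite /z /z' /P; apply/eqP; rewrite eq_complex /=.
    by apply/andP; split; apply/eqP; ring.
  rewrite normcM normc_real gtr0_norm// => h.
  have : e ^+ 2 * normc (phi.[t%:C] - (e / P)%:C) <= e ^+ 2 * e.
    rewrite -exprSr (le_trans _ h)// ler_wpM2r ?normc_ge0// /P.
    by rewrite lerDr sqr_ge0.
  by rewrite ler_pM2l ?exprn_gt0.
Qed.

End PoissonApproximation.

(** * Calculus on [0,1] with antiderivatives in place of integrals *)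

Section UnitIntervalCalculus.
Context {R : realType}.
Implicit Types (f g : R -> R) (t : R).

(** These are the hypotheses of the mean value theorem: derivatives inside, continuity up to the
    ends. *)
Definition rdiff f f' : Prop :=
  (forall t, t \in `]0, 1[ -> is_derive t 1 f (f' t)) /\
  {within `[0, 1], continuous f}.

Lemma rdiff_ext f f' g g' : (forall t, f t = g t) ->
  (forall t, t \in `]0, 1[ -> f' t = g' t) -> rdiff f f' -> rdiff g g'.
Proof.
move=> fg fg' [df cf]; have <- : f = g by apply/funext.
by split=> // t t01; rewrite -fg'//; exact: df.
Qed.

Lemma rdiff_everywhere f f' : (forall t, is_derive t 1 f (f' t)) -> rdiff f f'.
Proof.
move=> df; split=> [t _|]; first exact: df.
apply: continuous_subspaceT => t.
by apply: differentiable_continuous; apply/derivable1_diffP; case: (df t).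
Qed.

Lemma rdiffD f f' g g' : rdiff f f' -> rdiff g g' ->
  rdiff (fun t => f t + g t) (fun t => f' t + g' t).
Proof.
move=> [df cf] [dg cg]; split=> [t t01|].
  by have := df t t01; have := dg t t01 => ? ?; exact: is_deriveD.
by move=> x; apply: continuousD; [exact: cf|exact: cg].
Qed.

Lemma rdiffM f f' g g' : rdiff f f' -> rdiff g g' ->
  rdiff (fun t => f t * g t) (fun t => f' t * g t + f t * g' t).
Proof.
move=> [df cf] [dg cg]; split=> [t t01|].
  have := df t t01; have := dg t t01 => ? ?.
  apply: (is_derive_eq (@is_deriveM R R f g t 1 (f' t) (g' t) _ _)).
  by rewrite /GRing.scale/=; ring.
by move=> x; apply: continuousM; [exact: cf|exact: cg].
Qed.

Lemma rdiff_cst (c : R) : rdiff (fun=> c) (fun=> 0).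
Proof. by apply: rdiff_everywhere => t; exact: is_derive_cst. Qed.

Lemma rdiffZ c f f' : rdiff f f' -> rdiff (fun t => c * f t) (fun t => c * f' t).
Proof.
move=> hf; apply: rdiff_ext (rdiffM (rdiff_cst c) hf) => // t _.
by rewrite mul0r add0r.
Qed.

Lemma rdiffB f f' g g' : rdiff f f' -> rdiff g g' ->
  rdiff (fun t => f t - g t) (fun t => f' t - g' t).
Proof.
move=> hf hg; apply: rdiff_ext (rdiffD hf (rdiffZ (-1) hg)) => t *;
  by rewrite mulN1r.
Qed.

Lemma rdiff_id : rdiff id (fun=> 1).
Proof. by apply: rdiff_everywhere => t; exact: is_derive_id. Qed.

Lemma rdiff_affine_comp (f f' : R -> R) (c t0 : R) :
  (forall x : R, is_derive x 1 f (f' x)) ->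
  rdiff (fun t => f (c * (t - t0))) (fun t => c * f' (c * (t - t0))).
Proof.
move=> df; apply: rdiff_everywhere => s.
have ha : is_derive s (1 : R) (fun t : R => c * (t - t0)) c.
  have -> : (fun t : R => c * (t - t0)) = ((c \*: (@id R : R -> R)) + cst (- (c * t0))).
    by apply/funext => t; rewrite /= mulrDr mulrN.
  apply: is_derive_eq.
  by rewrite /GRing.scale/= mulr1 subr0.
by rewrite mulrC; exact: (@is_derive1_comp _ f (fun t => c * (t - t0)) s).
Qed.

(** Plays the part of the monotonicity of the integral. *)
Lemma rdiff_le f f' g g' a b : rdiff f f' -> rdiff g g' ->
  (forall t, t \in `]a, b[ -> f' t <= g' t) ->
  0 <= a -> a <= b -> b <= 1 -> f b - f a <= g b - g a.
Proof.
move=> hf hg fg a0 ab b1.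
have [dh ch] := rdiffB hg hf.
have sub t : t \in `]a, b[ -> t \in `]0, 1[.
  by rewrite !in_itv/= => /andP[at_ tb]; rewrite (le_lt_trans a0)// (lt_le_trans tb).
have [<-|neq] := eqVneq a b; first by rewrite !subrr.
have ltab : a < b by rewrite lt_neqAle neq.
have cch : {within `[a, b], continuous (fun t => g t - f t)}.
  apply: continuous_subspaceW ch => t/=; rewrite !in_itv/= => /andP[at_ tb].
  by rewrite (le_trans a0)// (le_trans tb).
have [c cab hc] := MVT ltab (fun t tab => dh t (sub t tab)) cch.
have h : 0 <= (g' c - f' c) * (b - a).
  by rewrite mulr_ge0// subr_ge0// fg.
by move: h; rewrite -hc; lra.
Qed.

Definition cdiff (f f' : R -> R[i]) : Prop :=
  rdiff (fun t => complex.Re (f t)) (fun t => complex.Re (f' t)) /\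
  rdiff (fun t => complex.Im (f t)) (fun t => complex.Im (f' t)).

Implicit Types F G : R -> R[i].

Lemma cdiff_ext F F' G G' : (forall t, F t = G t) ->
  (forall t, t \in `]0, 1[ -> F' t = G' t) -> cdiff F F' -> cdiff G G'.
Proof.
move=> FG FG' [hr hi]; split; [apply: rdiff_ext hr|apply: rdiff_ext hi] => t *;
  by rewrite /= ?FG ?FG'.
Qed.

Lemma complexReD (z w : R[i]) : complex.Re (z + w) = complex.Re z + complex.Re w.
Proof. by case: z; case: w. Qed.

Lemma complexImD (z w : R[i]) : complex.Im (z + w) = complex.Im z + complex.Im w.
Proof. by case: z; case: w. Qed.

Lemma complexReM (z w : R[i]) : complex.Re (z * w) =
  complex.Re z * complex.Re w - complex.Im z * complex.Im w.
Proof. by case: z; case: w. Qed.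

Lemma complexImM (z w : R[i]) : complex.Im (z * w) =
  complex.Re z * complex.Im w + complex.Im z * complex.Re w.
Proof. by case: z; case: w. Qed.

Lemma cdiffD F F' G G' : cdiff F F' -> cdiff G G' ->
  cdiff (fun t => F t + G t) (fun t => F' t + G' t).
Proof.
move=> [fr fi] [gr gi]; split; [apply: rdiff_ext (rdiffD fr gr)
  |apply: rdiff_ext (rdiffD fi gi)] => t * /=; by rewrite ?complexReD ?complexImD.
Qed.

Lemma cdiffM F F' G G' : cdiff F F' -> cdiff G G' ->
  cdiff (fun t => F t * G t) (fun t => F' t * G t + F t * G' t).
Proof.
move=> [fr fi] [gr gi]; split.
- apply: rdiff_ext (rdiffB (rdiffM fr gr) (rdiffM fi gi)) => t * /=.
    by rewrite complexReM.
  by rewrite complexReD !complexReM; ring.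
- apply: rdiff_ext (rdiffD (rdiffM fr gi) (rdiffM fi gr)) => t * /=.
    by rewrite complexImM.
  by rewrite complexImD !complexImM; ring.
Qed.

Lemma cdiff_cst (c : R[i]) : cdiff (fun=> c) (fun=> 0).
Proof. by split; exact: rdiff_cst. Qed.

Lemma cdiffZ c F F' : cdiff F F' -> cdiff (fun t => c * F t) (fun t => c * F' t).
Proof.
move=> hF; apply: cdiff_ext (cdiffM (cdiff_cst c) hF) => // t _.
by rewrite mul0r add0r.
Qed.

Lemma cdiff_sum (I : Type) (s : seq I) (F F' : I -> R -> R[i]) :
  (forall i, cdiff (F i) (F' i)) ->
  cdiff (fun t => \sum_(i <- s) F i t) (fun t => \sum_(i <- s) F' i t).
Proof.
move=> hF; elim: s => [|i s IH].
  by apply: cdiff_ext (cdiff_cst 0) => t *; rewrite big_nil.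
by apply: cdiff_ext (cdiffD (hF i) IH) => t *; rewrite big_cons.
Qed.

Lemma cdiff_horner (p : {poly R[i]}) :
  cdiff (fun t => p.[t%:C]) (fun t => p^`().[t%:C]).
Proof.
elim/poly_ind : p => [|p c IH].
  by apply: cdiff_ext (cdiff_cst 0) => t *; rewrite ?deriv0 horner0.
have hX : cdiff (fun t => t%:C) (fun=> 1) by split; [exact: rdiff_id|exact: rdiff_cst].
apply: cdiff_ext (cdiffD (cdiffM IH hX) (cdiff_cst c)) => t *.
  by rewrite !hornerE.
by rewrite derivD derivC derivM derivX !hornerE.
Qed.

Lemma cdiff_Re_conjM (c : R[i]) F F' : cdiff F F' ->
  rdiff (fun t => complex.Re (c * F t)) (fun t => complex.Re (c * F' t)).
Proof. by move=> /(cdiffZ c)[]. Qed.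

Lemma cdiff_le F F' g g' a b : cdiff F F' -> rdiff g g' ->
  (forall t, t \in `]a, b[ -> normc (F' t) <= g' t) ->
  0 <= a -> a <= b -> b <= 1 -> normc (F b - F a) <= g b - g a.
Proof.
move=> hF hg Fg a0 ab b1; set w := F b - F a.
have conjw : complex.Re (w^* * w) = normc w ^+ 2.
  by case: (w) => x y; rewrite /= /normc sqr_sqrtr ?addr_ge0 ?sqr_ge0//; ring.
have nconj : normc (w^*) = normc w by case: (w) => x y; rewrite /normc /= sqrrN.
have h : normc w ^+ 2 <= normc w * (g b - g a).
  have := rdiff_le (cdiff_Re_conjM (w^*) hF) (rdiffZ (normc w) hg) _ a0 ab b1.
  rewrite -[in X in _ -> X]conjw {2 3}/w.
  have -> : w^* * (F b - F a) = w^* * F b + (-1) * (w^* * F a) by ring.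
  rewrite complexReD [complex.Re (-1 * _)]complexReM /= oppr0 mul0r subr0 mulN1r mulrBr.
  apply=> t t01; have := ler_wpM2l (normc_ge0 w) (Fg t t01).
  rewrite -nconj -normcM => h; rewrite nconj in h *.
  exact: le_trans (le_trans (ler_norm _) (normc_ge_normRe _)) h.
have := normc_ge0 w; rewrite le_eqVlt => /predU1P[<-|w0].
  have := rdiff_le (rdiff_cst 0) hg _ a0 ab b1; rewrite subrr; apply=> t t01.
  exact: le_trans (normc_ge0 _) (Fg t t01).
by move: h; rewrite expr2 ler_pM2l.
Qed.

End UnitIntervalCalculus.

(** * Elementary substitutes for Stirling's formula *)

Section DecayingSequences.
Context {R : realType}.

Lemma eventually_nonincreasing_bounded (x : nat -> R) (n0 : nat) :
  (forall n, (n0 <= n)%N -> x n.+1 <= x n) -> exists2 B, 0 < B & forall n, x n <= B.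
Proof.
move=> hx; exists (1 + \sum_(i < n0.+1) `|x i|).
  by rewrite ltr_pwDl// sumr_ge0.
have small n : (n <= n0)%N -> x n <= 1 + \sum_(i < n0.+1) `|x i|.
  rewrite -ltnS => ln; rewrite (bigD1 (Ordinal ln))//= addrCA.
  by rewrite (le_trans (ler_norm _))// lerDl addr_ge0// sumr_ge0.
elim=> [|n IH]; first exact: small.
by have [ln|ln] := leqP n.+1 n0; [exact: small|rewrite (le_trans _ IH)// hx].
Qed.

(** This is (1 - 1/(n+1))^(n+1) <= 1/e, cleared of denominators. It controls the ratio of
    consecutive terms of (e/n)^n. *)
Lemma expR1_powS (n : nat) : (0 < n)%N ->
  expR 1 * n%:R ^+ n.+1 <= n.+1%:R ^+ n.+1 :> R.
Proof.
move=> n0; set s : R := n.+1%:R.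
have s0 : 0 < s by [].
have h : 1 - s^-1 <= expR (- s^-1) by exact: expR_ge1Dx.
have h1 : (1 - s^-1) ^+ n.+1 <= expR (-1).
  have -> : expR (-1) = expR (- s^-1) ^+ n.+1.
    by rewrite -expRM_natl mulrN mulfV// gt_eqF.
  rewrite lerXn2r// nnegrE ?expR_ge0// subr_ge0 invf_le1// ler1n//.
rewrite expRN in h1.
have -> : n%:R = s * (1 - s^-1) :> R.
  by rewrite mulrBr mulr1 mulfV ?gt_eqF// /s -natr1 addrK.
rewrite exprMn mulrCA ger_pMr ?exprn_gt0//.
by rewrite mulrC -ler_pdivlMr ?expR_gt0// mul1r.
Qed.

Variables (beta kap : R) (K : nat).
Hypotheses (beta0 : 0 < beta) (bk1 : 1 < beta * kap).

(** The decay rate against a factorial leaves beta^-k up to powers of k, and the strict inequality 1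
    < [beta * kap] absorbs these powers together with the shifts [K] and [q]. The quotient of the
    two sides is eventually nonincreasing. *)
Lemma decay_rate_fact (q : nat) : exists2 B, 0 < B &
  forall k, (0 < k)%N ->
   (expR 1 / (beta * (K + k)%:R)) ^+ (K + k) * (k + q)`!%:R <= B * kap ^+ k.
Proof.
have bk0 : 0 < beta * kap by exact: lt_trans bk1.
have kap0 : 0 < kap by rewrite -(pmulr_rgt0 _ beta0).
pose y n : R := (expR 1 / (beta * n%:R)) ^+ n.
have y0 n : 0 <= y n by rewrite exprn_ge0// divr_ge0 ?expR_ge0// mulr_ge0 ?(ltW beta0).
have yS n : (0 < n)%N -> y n.+1 * (beta * n%:R) <= y n.
  move=> n0; have nr0 : 0 < n%:R :> R by rewrite ltr0n.
  rewrite /y !expr_div_n -ler_pdivlMr ?mulr_gt0//.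
  rewrite ler_pdivrMr ?exprn_gt0 ?mulr_gt0//.
  rewrite !exprMn exprS.
  have h := expR1_powS n0.
  have -> : expR 1 ^+ n / (beta ^+ n * n%:R ^+ n) / (beta * n%:R) *
      (beta ^+ n.+1 * n.+1%:R ^+ n.+1) = expR 1 ^+ n * (n.+1%:R ^+ n.+1 / n%:R ^+ n.+1).
    rewrite !exprS; field; rewrite ?gt_eqF ?exprn_gt0//.
  by rewrite mulrC ler_wpM2l ?exprn_ge0 ?expR_ge0// ler_pdivlMr ?exprn_gt0.
pose x k : R := y (K + k)%N * (k + q)`!%:R / kap ^+ k.
(* From this index on k + q + 1 <= beta kap k, so the ratio (k + q + 1) / (beta kap (K + k)) of
   consecutive terms is at most 1. *)
pose n0 := (Num.bound ((q.+1%:R) / (beta * kap - 1))).+1.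
have [k hk|B B0 hB] := @eventually_nonincreasing_bounded x n0.
  have k0 : (0 < k)%N by exact: leq_trans hk.
  have Kk0 : (0 < K + k)%N by rewrite addn_gt0 k0 orbT.
  have hk1 : (k + q).+1%:R <= beta * kap * (K + k)%:R.
    have h1 : q.+1%:R <= (beta * kap - 1) * k%:R.
      rewrite mulrC -ler_pdivrMr ?subr_gt0// (le_trans (ltW (archi_boundP _)))//.
        by rewrite divr_ge0// subr_ge0 ltW.
      by rewrite ler_nat ltnW.
    rewrite -addnS natrD.
    have : k%:R <= (K + k)%:R :> R by rewrite ler_nat leq_addl.
    move: bk1; nra.
  rewrite /x addnS addSn factS natrM exprS invfM.
  rewrite -(ler_pM2r (mulr_gt0 beta0 (_ : 0 < (K + k)%:R))) ?ltr0n//.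
  have -> : y (K + k).+1 * ((k + q).+1%:R * (k + q)`!%:R) * (kap^-1 / kap ^+ k) * (beta * (K + k)%:R) =
    (y (K + k).+1 * (beta * (K + k)%:R)) * ((k + q)`!%:R / kap ^+ k) * ((k + q).+1%:R / kap).
    by ring.
  have -> : y (K + k)%N * (k + q)`!%:R / kap ^+ k * (beta * (K + k)%:R) =
     y (K + k)%N * ((k + q)`!%:R / kap ^+ k) * (beta * (K + k)%:R) by ring.
  apply: ler_pM.
  - by rewrite !mulr_ge0 ?y0 ?invr_ge0 ?exprn_ge0 ?(ltW kap0) ?(ltW beta0).
  - by rewrite divr_ge0// ltW.
  - by rewrite ler_wpM2r ?divr_ge0 ?exprn_ge0 ?(ltW kap0)// yS.
  - by rewrite ler_pdivrMr// mulrAC.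
exists B => // k _; have := hB k.
by rewrite /x ler_pdivrMr ?exprn_gt0.
Qed.

Lemma pow_fact_bounded (x : R) : 0 <= x ->
  exists2 B, 0 < B & forall k, x ^+ k / k`!%:R <= B.
Proof.
move=> x0; apply: (@eventually_nonincreasing_bounded _ (Num.bound x)) => n hn.
rewrite factS natrM invfM exprS mulrACA ler_piMl//.
  by rewrite divr_ge0 ?exprn_ge0.
rewrite ler_pdivrMr// mul1r (le_trans (ltW (archi_boundP x0)))// ler_nat.
exact: leq_trans hn _.
Qed.

End DecayingSequences.

(** * The free part of a channel tested against the chain *)

Section FreeTail.
Context {R : realType}.

(** The factorial in the bound on [a] cancels the one in [tchain_coef_le], taken at the constant
    coefficient with r = 1/rho. What is left is a geometric series of ratio kap th / rho < 1, hence
    a bound uniform in the length n. *)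
Lemma chain_boundary_bounded (kap th rho B : R) (q : nat) (a : nat -> R[i]) :
  0 < kap -> 1 < th -> 0 < rho <= 1 -> kap * th < rho ->
  3 <= (th - 1) * q.+1%:R -> 0 < B ->
  (forall k, (0 < k)%N -> normc (a k) * (k + q)`!%:R <= B * kap ^+ k) ->
  exists2 C, 0 < C & forall (phi : {poly R[i]}) n,
    normc (\sum_(k < n) a k.+1 * (tchain phi k.+1).[0]) <= C * wnorm rho phi.
Proof.
move=> kap0 th1 /andP[rho0 rho1] ktr hq B0 ha.
set y := kap * th / rho.
have th0 : 0 < th by lra.
have y0 : 0 <= y by rewrite divr_ge0 ?mulr_ge0 ?ltW.
have y1 : y < 1 by rewrite ltr_pdivrMr// mul1r.
exists (B * kap / (1 - y)); first by rewrite divr_gt0 ?mulr_gt0 ?subr_gt0.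
move=> phi n; have w0 : 0 <= wnorm rho phi by rewrite wnorm_ge0// ltW.
have term k : normc (a k.+1 * (tchain phi k.+1).[0]) <= B * kap * wnorm rho phi * y ^+ k.
  rewrite normcM horner_coef0.
  have r1 : 1 <= rho^-1 by rewrite invf_ge1.
  have h1 := tchain_coef_le phi k 0 r1 th1 hq.
  rewrite mulr1 addn0 invrK in h1.
  have h2 := ha k.+1 isT.
  have f0 : 0 < (k + q)`!%:R :> R by rewrite ltr0n fact_gt0.
  have h3 : normc (a k.+1) * (k + q)`!%:R <= B * kap ^+ k.+1.
    rewrite (le_trans _ h2)// ler_wpM2l ?normc_ge0// ler_nat.
    by rewrite leq_fact// leq_add2r.
  apply: (le_trans (ler_wpM2l (normc_ge0 _) h1)).
  have -> : normc (a k.+1) * (th ^+ k * (k + q)`!%:R * rho^-1 ^+ k * wnorm rho phi) =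
    (normc (a k.+1) * (k + q)`!%:R) * (th ^+ k * rho^-1 ^+ k * wnorm rho phi) by ring.
  have -> : B * kap * wnorm rho phi * y ^+ k =
    B * kap ^+ k.+1 * (th ^+ k * rho^-1 ^+ k * wnorm rho phi).
    by rewrite /y !exprMn exprS; ring.
  by rewrite ler_wpM2r// !mulr_ge0 ?exprn_ge0 ?invr_ge0 ?(ltW th0) ?(ltW rho0).
apply: (le_trans (normc_sum _ _ _)).
apply: (@le_trans _ _ (\sum_(k < n) B * kap * wnorm rho phi * y ^+ k)).
  by apply: ler_sum => k _; exact: term.
rewrite -mulr_sumr.
have -> : B * kap / (1 - y) * wnorm rho phi = B * kap * wnorm rho phi * (1 - y)^-1 by ring.
rewrite ler_wpM2l ?mulr_ge0 ?(ltW B0) ?(ltW kap0)//.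
rewrite -[leRHS]mul1r ler_pdivlMr ?subr_gt0//.
have -> : (\sum_(k < n) y ^+ k) * (1 - y) = 1 - y ^+ n.
  by rewrite -opprB -[1 - y ^+ n]opprB mulrN subrX1 mulrC.
by rewrite gerBl exprn_ge0.
Qed.

Variables (v v' : nat -> R -> R[i]).
Hypothesis hv : forall k, cdiff (v k) (v' k).
Hypothesis hfree : forall k (t : R), t \in `]0, 1[ ->
  v' k.+1 t = 'i%C * (2 * v k.+1 t - v k t - v k.+2 t).
Variable M : R.
Hypothesis hM : forall k (t : R), 0 <= t <= 1 -> normc (v k t) <= M.

(** Each integration of the equation uses one more neighbour down the chain and gains a factor A:
    the derivative is at most 4 times the previous bound, and 4 exp(4 A s) has antiderivative exp(4
    A s) / A. Only the data at time 0 and the uniform bound [M] enter. *)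
Lemma tail_decay (A C : R) : 1 <= A -> M <= C -> 0 <= C ->
  (forall k, normc (v k 0) <= C / A ^+ k) ->
  forall j k (t : R), (j <= k)%N -> 0 <= t <= 1 ->
  normc (v k t) <= C / A ^+ j * expR (4 * A * t).
Proof.
move=> A1 MC C0 h0; have A0 : 0 < A by lra.
elim=> [|j IH] k t jk /[dup] t01 /andP[t0 t1].
  rewrite expr0 divr1 (le_trans (hM _ t01))// (le_trans MC)// ler_peMr//.
  rewrite -expR0 ler_expR !mulr_ge0// ltW//.
case: k jk => // k jk.
pose g t := C / A ^+ j.+1 * expR (4 * A * t).
have hg : rdiff g (fun t => 4 * (C / A ^+ j * expR (4 * A * t))).
  apply: rdiff_ext (rdiffZ (C / A ^+ j.+1) (rdiff_affine_comp (4 * A) 0 (@is_derive_expR R))) => s *.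
    by rewrite /= subr0.
  by rewrite /= subr0 exprS; field; rewrite !gt_eqF ?exprn_gt0.
have hbound s : s \in `]0, t[ -> normc (v' k.+1 s) <= 4 * (C / A ^+ j * expR (4 * A * s)).
  rewrite in_itv/= => /andP[s0 st].
  have s1 : s < 1 by exact: lt_le_trans t1.
  have s01 : s \in `]0, 1[ by rewrite in_itv/= s0.
  have s01' : 0 <= s <= 1 by rewrite !ltW.
  rewrite hfree// normcM normc_i mul1r.
  have h1 := IH k.+1 s (ltnW jk) s01'.
  have h2 := IH k s jk s01'.
  have h3 := IH k.+2 s (leqW (leqW jk)) s01'.
  have h4 := normcB (2 * v k.+1 s - v k s) (v k.+2 s).
  have h5 := normcB (2 * v k.+1 s) (v k s).
  rewrite normcM normc_nat in h5.
  lra.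
have h := cdiff_le (hv k.+1) hg hbound (lexx 0) t0 t1.
have g0 : g 0 = C / A ^+ j.+1 by rewrite /g mulr0 expR0 mulr1.
have h1 : normc (v k.+1 0) <= g 0.
  rewrite g0 (le_trans (h0 _))// ler_wpM2l// lef_pV2 ?posrE ?exprn_gt0//.
  by rewrite ler_weXn2l.
rewrite -[X in normc X](subrK (v k.+1 0)) (le_trans (normcD _ _))//.
by rewrite -/(g t); lra.
Qed.

(* The derivative telescopes because [tchain] is the transposed recursion. *)
Lemma chain_potential_cdiff (phi : {poly R[i]}) n :
  cdiff (fun t => 'i%C * \sum_(k < n) v k.+1 t * (tchain phi k.+1).[t%:C])
    (fun t => v 0 t * phi.[t%:C] - v n t * (tchain phi n.+1).[t%:C] +
              v n.+1 t * (tchain phi n).[t%:C]).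
Proof.
have h := @cdiff_sum R _ (index_enum 'I_n) _ _
  (fun k : 'I_n => cdiffM (hv k.+1) (cdiff_horner (tchain phi k.+1))).
apply: cdiff_ext (cdiffZ 'i%C h) => // t t01; rewrite /=.
elim: n {h} => [|n IH]; first by rewrite big_ord0 horner0; ring.
rewrite big_ord_recr/= mulrDr IH hfree//.
rewrite !hornerE/=.
have ii : 'i%C * 'i%C = -1 :> R[i] by rewrite -expr2 sqr_i.
set T0 := (tchain phi n).[_]; set T1 := (tchain phi n.+1).[_].
set d := (_^`()).[_].
ring: ii.
Qed.

End FreeTail.

Section FreeTailVanishing.
Context {R : realType}.
Variables (v v' : nat -> R -> R[i]).
Hypothesis hv : forall k, cdiff (v k) (v' k).
Hypothesis hfree : forall k (t : R), t \in `]0, 1[ ->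
  v' k.+1 t = 'i%C * (2 * v k.+1 t - v k t - v k.+2 t).
Variable M : R.
Hypothesis hM : forall k (t : R), 0 <= t <= 1 -> normc (v k t) <= M.
Variables (beta C0 : R) (K : nat).
Hypotheses (beta0 : 0 < beta) (C00 : 0 < C0).
Hypothesis hdecay : forall k (t : R), (0 < k)%N -> t = 0 \/ t = 1 ->
  normc (v k t) <= C0 * (expR 1 / (beta * (K + k)%:R)) ^+ (K + k).

Let M0 : 0 <= M.
Proof. by apply: le_trans (normc_ge0 _) (hM 0 (_ : 0 <= 0 <= 1)); rewrite lexx ler01. Qed.

Lemma tail_superexp (A : R) : 1 <= A -> exists2 C, 0 < C &
  forall k (t : R), 0 <= t <= 1 -> normc (v k t) <= C / A ^+ k.
Proof.
move=> A1; have A0 : 0 < A by lra.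
(* Any [kap] with [beta * kap] > 1 would do: the initial data are O(kap^k / k!), and the factorial
   beats A^k. *)
pose kap := 2 / beta.
have kap0 : 0 < kap by rewrite divr_gt0.
have bk1 : 1 < beta * kap by rewrite /kap mulrCA mulfV ?gt_eqF// mulr1; lra.
have [B B0 hB] := decay_rate_fact K beta0 bk1 0.
have [B' B'0 hB'] := @pow_fact_bounded R (A * kap) (mulr_ge0 (ltW A0) (ltW kap0)).
pose C := M + C0 * B * B'.
have C1 : 0 < C by rewrite ltr_wpDl// !mulr_gt0.
have h0 k : normc (v k 0) <= C / A ^+ k.
  case: k => [|k].
    rewrite expr0 divr1 (le_trans (hM _ _)) ?lexx ?ler01//.
    by rewrite /C lerDl !mulr_ge0// ltW.
  rewrite ler_pdivlMr ?exprn_gt0//.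
  have f0 : 0 < k.+1`!%:R :> R by rewrite ltr0n fact_gt0.
  have h1 := hdecay (ltn0Sn k) (or_introl erefl).
  have h2 := hB k.+1 isT; rewrite addn0 in h2.
  have h3 : normc (v k.+1 0) <= C0 * B * (kap ^+ k.+1 / k.+1`!%:R).
    rewrite (le_trans h1)// -mulrA ler_pM2l// mulrA ler_pdivlMr//.
  apply: (@le_trans _ _ (C0 * B * B')); last by rewrite /C lerDr.
  apply: (le_trans (ler_wpM2r (exprn_ge0 _ (ltW A0)) h3)).
  rewrite -[leLHS]mulrA; apply: ler_wpM2l; first by rewrite mulr_ge0 ?(ltW C00) ?(ltW B0).
  by rewrite mulrAC [_ * A ^+ _]mulrC -exprMn hB'.
exists (C * expR (4 * A)); first by rewrite mulr_gt0 ?expR_gt0.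
move=> k t t01.
have MC : M <= C by rewrite /C lerDl !mulr_ge0// ltW.
apply: le_trans (tail_decay hv hfree hM A1 MC (ltW C1) h0 (leqnn k) t01) _.
have -> : C * expR (4 * A) / A ^+ k = C / A ^+ k * expR (4 * A) by rewrite mulrAC.
rewrite ler_pM2l ?divr_gt0 ?exprn_gt0//.
by rewrite ler_expR ler_piMr ?mulr_ge0 ?(ltW A0)//; case/andP: t01.
Qed.

Lemma chain_error_small (phi : {poly R[i]}) (e : R) : 0 < e -> exists n,
  forall t : R, 0 <= t <= 1 ->
  normc (v n.+1 t * (tchain phi n).[t%:C] - v n t * (tchain phi n.+1).[t%:C]) <= e.
Proof.
move=> e0; set D : R := (size phi)%:R + 3; set X := wnorm 1 phi.
have X0 : 0 <= X by exact: wnorm_ge0.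
have D3 : 3 <= D by rewrite /D lerDr.
have D0 : 0 < D by lra.
(* [D] is the growth rate of the test functions of [phi]; twice that rate leaves a factor 2^-n. *)
have [|C C1 hC] := @tail_superexp (2 * D); first lra.
have : (2^-1 : R) ^+ n @[n --> \oo] --> (0 : R).
  by apply: cvg_expr; rewrite ger0_norm// invf_lt1// ltr1n.
pose E := C * X * (D + 1).
have E0 : 0 <= E by rewrite /E !mulr_ge0//; lra.
have e' : 0 < e / (E + 1) by rewrite divr_gt0//; lra.
move=> /cvgrPdist_le/(_ _ e') [n _ /(_ n (leqnn n))].
rewrite sub0r normrN ger0_norm ?exprn_ge0// => hn.
exists n => t t01.
have hT m : normc (tchain phi m).[t%:C] <= D ^+ m * X.
  exact: le_trans (normc_horner_le_wnorm _ t01) (tchain_growth _ _).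
have hterm m l : normc (v m t * (tchain phi l).[t%:C]) <= C / (2 * D) ^+ m * (D ^+ l * X).
  by rewrite normcM ler_pM ?normc_ge0 ?hC.
apply: (le_trans (normcB _ _)).
apply: (le_trans (lerD (hterm _ _) (hterm _ _))).
have -> : C / (2 * D) ^+ n.+1 * (D ^+ n * X) + C / (2 * D) ^+ n * (D ^+ n.+1 * X) =
   C * X * (2^-1 / D + D) * 2^-1 ^+ n.
  rewrite !exprMn exprVn !exprS; field; rewrite !gt_eqF ?exprn_gt0//.
have h1 : 2^-1 / D <= 1.
  by rewrite ler_pdivrMr//; lra.
have h2 : C * X * (2^-1 / D + D) <= E + 1.
  have := ler_wpM2l (mulr_ge0 (ltW C1) X0) h1; rewrite /E; lra.
rewrite (le_trans (ler_wpM2r _ h2)) ?exprn_ge0// mulrC -ler_pdivlMr//; lra.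
Qed.

Lemma tail_boundary_bounded (rho : R) : beta^-1 < rho -> rho <= 1 ->
  exists2 B, 0 < B & forall (phi : {poly R[i]}) n (t : R), t = 0 \/ t = 1 ->
    normc (\sum_(k < n) v k.+1 t * (tchain phi k.+1).[t%:C]) <=
    B * wnorm rho (phi \Po ('X + t%:C%:P)).
Proof.
move=> br rho1.
have b0 : 0 < beta^-1 by rewrite invr_gt0.
have rho0 : 0 < rho by exact: lt_trans br.
(* The room between 1/beta and rho is shared: [kap] exceeds 1/beta, to dominate the data, and [th]
   exceeds 1, to absorb the lower-order terms, with kap th = (kap + rho) / 2 still below rho. *)
pose kap := (beta^-1 + rho) / 2; pose th := (1 + rho / kap) / 2.
have kap0 : 0 < kap by rewrite /kap; lra.
have bk : beta^-1 < kap by rewrite /kap; lra.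
have kr : kap < rho by rewrite /kap; lra.
have rk1 : 1 < rho / kap by rewrite ltr_pdivlMr// mul1r.
have th1 : 1 < th by rewrite /th; lra.
have kth : kap * th < rho.
  have -> : kap * th = (kap + rho) / 2.
    by rewrite /th mulrA mulrDr mulr1 mulrCA mulfV ?gt_eqF// mulr1.
  lra.
have bk1 : 1 < beta * kap by rewrite mulrC -ltr_pdivrMr// mul1r.
pose q := Num.bound (3 / (th - 1)).
have hq : 3 <= (th - 1) * q.+1%:R.
  have th10 : 0 < th - 1 by lra.
  rewrite mulrC -ler_pdivrMr// (le_trans (ltW (archi_boundP _)))//.
    by rewrite divr_ge0// ltW.
  by rewrite ler_nat.
have [B B0 hB] := decay_rate_fact K beta0 bk1 q.
have ha (t : R) : t = 0 \/ t = 1 -> forall k, (0 < k)%N ->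
    normc (v k t) * (k + q)`!%:R <= (C0 * B) * kap ^+ k.
  move=> ht k k0; rewrite -mulrA.
  apply: (le_trans (ler_wpM2r _ (hdecay k0 ht))) => //.
  by rewrite -mulrA ler_pM2l// hB.
have rho01 : 0 < rho <= 1 by rewrite rho0.
have CB0 : 0 < C0 * B by rewrite mulr_gt0.
have [B1 B10 h0] := chain_boundary_bounded kap0 th1 rho01 kth hq CB0 (ha 0 (or_introl erefl)).
have [B2 B20 h1] := chain_boundary_bounded kap0 th1 rho01 kth hq CB0 (ha 1 (or_intror erefl)).
(* The recursion has constant coefficients, so it commutes with translation and the bound at 0 also
   serves at time 1. *)
have shift phi n (t : R) : \sum_(k < n) v k.+1 t * (tchain phi k.+1).[t%:C] =
    \sum_(k < n) v k.+1 t * (tchain (phi \Po ('X + t%:C%:P)) k.+1).[0].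
  by apply: eq_bigr => k _; rewrite tchain_shift horner_comp hornerD hornerX hornerC add0r.
exists (B1 + B2); first by rewrite addr_gt0.
move=> phi n t ht; rewrite shift.
have w0 : 0 <= wnorm rho (phi \Po ('X + t%:C%:P)) by rewrite wnorm_ge0// ltW.
have := mulr_ge0 (ltW B10) w0; have := mulr_ge0 (ltW B20) w0.
case: ht w0 => -> w0 ? ?.
- by rewrite (le_trans (h0 _ _))//; lra.
- by rewrite (le_trans (h1 _ _))//; lra.
Qed.

(** If a = v_0(t0) were nonzero, Re (conj(a) v_0) integrated against the Poisson kernel at t0 would
    stay above a positive multiple of |a|^2 as e tends to 0, while the boundary terms and all errors
    are O(e). *)
Lemma tail_vanishing (t0 : R) : beta^-1 < t0 -> beta^-1 < 1 - t0 -> v 0 t0 = 0.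
Proof.
move=> bt0 bt1.
have b0 : 0 < beta^-1 by rewrite invr_gt0.
have t00 : 0 < t0 by lra.
have t01 : t0 < 1 by lra.
have tin : 0 <= t0 <= 1 by rewrite !ltW.
set a := v 0 t0; apply: contrapT => /eqP a0.
have na0 : 0 < normc a.
  by rewrite lt_neqAle normc_ge0 andbT eq_sym; apply: contraNN a0 => /eqP/ComplexField.Normc.eq0_normc ->.
pose h t := complex.Re (a^* * v 0 t).
have nconj : normc (a^*) = normc a by case: (a) => x y; rewrite /normc /= sqrrN.
set s := normc a ^+ 2.
have s0 : 0 < s by rewrite exprn_gt0.
have hs : h t0 = s.
  by rewrite /h /s -/a; case: (a) => x y; rewrite /= /normc sqr_sqrtr ?addr_ge0 ?sqr_ge0//; ring.
have hlow t : 0 <= t <= 1 -> - (normc a * M) <= h t.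
  move=> t1; have h1 := normc_ge_normRe (a^* * v 0 t).
  rewrite normcM nconj in h1.
  have h2 := ler_wpM2l (ltW na0) (hM 0 t1).
  have h3 : `|complex.Re (a^* * v 0 t)| <= normc a * M by exact: le_trans h2.
  by rewrite ler_norml in h3; case/andP: h3.
(* A quadratic minorant spares splitting [0,1] near t0: the kernel times (t - t0)^2 is at most e
   everywhere. Continuity gives the minorant near t0, and a large [M2] gives it elsewhere. *)
have [M2 M20 hM2] : exists2 M2, 0 <= M2 & forall t, 0 <= t <= 1 -> s / 2 - M2 * (t - t0) ^+ 2 <= h t.
  have ch : {within `[0, 1], continuous h} := (cdiff_Re_conjM (a^*) (hv 0)).2.
  have [dl dl0 hdl] : exists2 dl, 0 < dl & forall t, 0 <= t <= 1 -> `|t - t0| < dl -> s / 2 <= h t.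
    have := (subspace_continuousP _ _).1 ch t0 _; rewrite /= in_itv/= => /(_ tin).
    move=> /cvgrPdist_le/(_ (s / 2) (divr_gt0 s0 (ltr0n _ 2))) hnear.
    have [dl /= dl0 hdl] : \forall t \near within `[0, 1] (nbhs t0), `|h t0 - h t| <= s / 2.
      by exact: hnear.
    exists dl => // t t1 td; have := hdl t; rewrite /ball_/= distrC => /(_ td).
    rewrite in_itv/= => /(_ t1); rewrite hs ler_norml => /andP[_]; lra.
  exists ((s / 2 + normc a * M) / dl ^+ 2).
    by rewrite divr_ge0 ?exprn_ge0 ?addr_ge0 ?mulr_ge0 ?(ltW na0) ?M0 ?divr_ge0 ?(ltW s0) ?(ltW dl0).
  move=> t t1; have [td|td] := ltP `|t - t0| dl.
    rewrite (le_trans _ (hdl t t1 td))// gerBl mulr_ge0 ?sqr_ge0// divr_ge0 ?exprn_ge0 ?(ltW dl0)//.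
    by rewrite addr_ge0 ?mulr_ge0 ?(ltW na0) ?M0 ?divr_ge0 ?(ltW s0).
  have h1 := hlow t t1.
  have h2 : (s / 2 + normc a * M) <= (s / 2 + normc a * M) / dl ^+ 2 * (t - t0) ^+ 2.
    rewrite [leRHS]mulrAC ler_pdivlMr ?exprn_gt0// ler_wpM2l//.
      by rewrite addr_ge0 ?mulr_ge0 ?(ltW na0) ?M0 ?divr_ge0 ?(ltW s0).
    by rewrite -[leRHS]real_normK ?num_real// lerXn2r ?nnegrE ?(ltW dl0).
  lra.
pose m := Num.min t0 (1 - t0).
have m0 : 0 < m by rewrite lt_min t00 subr_gt0.
have bm : beta^-1 < m by rewrite lt_min bt0.
pose rho := (beta^-1 + m) / 2.
have brho : beta^-1 < rho by rewrite /rho; lra.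
have rhom : rho < m by rewrite /rho; lra.
have m_t0 : m <= t0 by rewrite ge_min lexx.
have m_t1 : m <= 1 - t0 by rewrite ge_min lexx orbT.
have rho1 : rho <= 1 by lra.
have [B B0 hB] := tail_boundary_bounded brho rho1.
have [||| Kp Kp0 hKp] := @poisson_kernel_approx R rho t0; try lra.
(* The three terms pay for the quadratic loss, for the replacement of the kernel by [phi], and for
   the remainder of the chain; [Z] adds the boundary terms at the two ends. *)
pose c := M2 + normc a * M + normc a.
have c0 : 0 <= c by rewrite /c !addr_ge0 ?mulr_ge0 ?M0 ?(ltW na0).
pose Z := c + normc a * (2 * (B * Kp)).
have Z0 : 0 <= Z by rewrite /Z addr_ge0// !mulr_ge0// ltW.
have main e : 0 < e -> e <= m -> s * (pi / 4) <= Z * e.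
  move=> e0 em; have e1 : 0 < e <= 1 by rewrite e0/=; lra.
  have [phi [w0 w1 hphi]] := hKp e e1.
  have [n hn] := chain_error_small phi e0.
  pose W t := 'i%C * \sum_(k < n) v k.+1 t * (tchain phi k.+1).[t%:C].
  have hW := cdiff_Re_conjM (a^*) (chain_potential_cdiff hv hfree phi n).
  pose g t := s / 2 * atan (e^-1 * (t - t0)) + - (c * e) * t.
  have hg := rdiffD (rdiffZ (s / 2) (rdiff_affine_comp e^-1 t0 (@is_derive1_atan R)))
    (rdiffZ (- (c * e)) rdiff_id).
  have := rdiff_le hg hW _ (lexx 0) ler01 (lexx 1).
  have h1 t : t \in `]0, 1[ ->
       s / 2 * (e^-1 * (1 + (e^-1 * (t - t0)) ^+ 2)^-1) + - (c * e) * 1 <=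
       complex.Re (a^* * (v 0 t * phi.[t%:C] - v n t * (tchain phi n.+1).[t%:C] +
          v n.+1 t * (tchain phi n).[t%:C])).
    rewrite in_itv/= => /andP[tt0 tt1].
    have tt : 0 <= t <= 1 by rewrite !ltW.
    pose P := e / ((t - t0) ^+ 2 + e ^+ 2).
    have Q0 : 0 < (t - t0) ^+ 2 + e ^+ 2 by rewrite ltr_wpDl ?sqr_ge0 ?exprn_gt0.
    have P0 : 0 <= P by rewrite divr_ge0// ltW.
    have -> : e^-1 * (1 + (e^-1 * (t - t0)) ^+ 2)^-1 = P.
      by rewrite /P; field; rewrite !gt_eqF.
    have PQ : (t - t0) ^+ 2 * P <= e.
      rewrite /P mulrA ler_pdivrMr// mulrC ler_pM2l//.
      by rewrite lerDl sqr_ge0.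
    set er := v n.+1 t * (tchain phi n).[t%:C] - v n t * (tchain phi n.+1).[t%:C].
    have -> : a^* * (v 0 t * phi.[t%:C] - v n t * (tchain phi n.+1).[t%:C] +
          v n.+1 t * (tchain phi n).[t%:C]) =
          P%:C * (a^* * v 0 t) + (a^* * v 0 t * (phi.[t%:C] - P%:C) + a^* * er).
      by rewrite /er; ring.
    rewrite complexReD complexReD complexReM/= mul0r subr0 -/(h t).
    have k1 := normc_ge_normRe (a^* * v 0 t * (phi.[t%:C] - P%:C)).
    have k2 := normc_ge_normRe (a^* * er).
    rewrite !normcM nconj in k1 k2.
    have k3 : normc a * normc (v 0 t) * normc (phi.[t%:C] - P%:C) <= normc a * M * e.
      rewrite ler_pM ?mulr_ge0 ?normc_ge0 ?hphi//.
      by rewrite ler_wpM2l ?normc_ge0 ?hM.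
    have k4 : normc a * normc er <= normc a * e by rewrite ler_wpM2l ?normc_ge0 ?hn.
    have k5 := ler_wpM2l P0 (hM2 t tt).
    have k6 := ler_wpM2l M20 PQ.
    have := le_trans k1 k3; rewrite ler_norml => /andP[k7 _].
    have := le_trans k2 k4; rewrite ler_norml => /andP[k8 _].
    rewrite /c; lra.
  move=> /(_ h1); rewrite !mulr1 !mulr0 sub0r addr0.
  (* As e <= min(t0, 1 - t0), the kernel has mass at least pi/2 on [0,1]; with the factor s/2 this
     gives s pi/4. *)
  have at1 : pi / 4 <= atan (e^-1 * (1 - t0)).
    by rewrite -atan1 le_atan// mulrC ler_pdivlMr// mul1r; lra.
  have at0 : atan (e^-1 * - t0) <= - (pi / 4).
    by rewrite mulrN atanN lerN2 -atan1 le_atan// mulrC ler_pdivlMr// mul1r; lra.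
  have hb (t : R) : t = 0 \/ t = 1 -> wnorm rho (phi \Po ('X + t%:C%:P)) <= Kp * e ->
     `|complex.Re (a^* * ('i%C * \sum_(k < n) v k.+1 t * (tchain phi k.+1).[t%:C]))| <=
      normc a * (B * Kp) * e.
    move=> ht hw; rewrite (le_trans (normc_ge_normRe _))// !normcM nconj normc_i mul1r.
    rewrite -!mulrA ler_wpM2l ?normc_ge0// (le_trans (hB _ _ _ ht))// ler_wpM2l//.
    exact: ltW.
  have := hb 0 (or_introl erefl); rewrite addr0 comp_polyXr => /(_ w0).
  have := hb 1 (or_intror erefl) w1.
  rewrite !ler_norml => /andP[_ b1] /andP[b2 _] hh.
  have k1 := ler_wpM2l (ltW s0) at1.
  have k0 := ler_wpM2l (ltW s0) at0.
  rewrite /Z; lra.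
have pi0 := pi_gt0 R.
have sp : 0 < s * (pi / 4) by rewrite mulr_gt0// divr_gt0.
pose e := Num.min m (s * (pi / 4) / (2 * (Z + 1))).
have Z1 : 0 < 2 * (Z + 1) by lra.
have e0 : 0 < e by rewrite lt_min m0 divr_gt0.
have em : e <= m by rewrite ge_min lexx.
have : e <= s * (pi / 4) / (2 * (Z + 1)) by rewrite ge_min lexx orbT.
rewrite ler_pdivlMr// => he.
have := main e e0 em; nra.
Qed.

End FreeTailVanishing.

(** * From ell^2-valued functions to their coordinates *)

Section SquareSummableFamilies.
Context {R : realType} {A : countType}.
Implicit Types f g : A -> R[i].

Lemma esum_finite_support (x : A -> R) (s : seq A) : uniq s ->
  (forall a, 0 <= x a) -> (forall a, a \notin s -> x a = 0) ->
  \esum_(a in [set: A]) (x a)%:E = (\sum_(a <- s) x a)%:E.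
Proof.
move=> us x0 xs.
have -> : \esum_(a in [set: A]) (x a)%:E = \esum_(a in [set` s]) (x a)%:E.
  rewrite [RHS]esum_mkcond; apply: eq_esum => a _.
  case: ifPn => // nas; rewrite xs//; apply: contra nas => as_.
  by apply/mem_set.
have fs : finite_set [set` s] by apply/finite_seqP; exists s.
by rewrite esum_fset ?fsumEFin -?fsbig_seq// => a _; rewrite lee_fin.
Qed.

Lemma rsum_finite_support (x : A -> R) (s : seq A) : uniq s ->
  (forall a, a \notin s -> x a = 0) -> rsum x = \sum_(a <- s) x a.
Proof.
move=> us xs; rewrite /rsum.
rewrite (esum_finite_support us (funrpos_ge0 x)); last first.
  by move=> a /xs xa; rewrite /funrpos xa maxxx.
rewrite (esum_finite_support us (funrneg_ge0 x)); last first.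
  by move=> a /xs xa; rewrite /funrneg xa oppr0 maxxx.
rewrite /= -sumrB; apply: eq_bigr => a _.
by rewrite -[in RHS](funrposBneg x).
Qed.

Lemma csum_finite_support f (s : seq A) : uniq s ->
  (forall a, a \notin s -> f a = 0) -> csum f = \sum_(a <- s) f a.
Proof.
move=> us fs; rewrite /csum !(@rsum_finite_support _ s)//;
  try by move=> a /fs ->.
elim: s {us fs} => [|a s IH]; first by rewrite !big_nil.
by rewrite !big_cons -IH; case: (f a).
Qed.

Lemma ell2P f : ell2 f <-> exists B : R, forall s : seq A, uniq s ->
  \sum_(a <- s) normc (f a) ^+ 2 <= B.
Proof.
have f0 a : 0 <= normc (f a) ^+ 2 by exact: sqr_ge0.
split=> [hf|[B hB]].
  exists (fine (\esum_(a in [set: A]) (normc (f a) ^+ 2)%:E)) => s us.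
  rewrite -lee_fin fineK; last first.
    by rewrite ge0_fin_numE// esum_ge0// => a _; rewrite lee_fin.
  apply: esum_ge; exists [set` s].
    by split => //; apply/finite_seqP; exists s.
  by rewrite -fsbig_seq// sumEFin.
rewrite /ell2 (@le_lt_trans _ _ B%:E) ?ltry//.
apply: ge_ereal_sup => /= _ [X [finX _] <-].
have [s0 Xs] := (finite_seqP X).1 finX.
have -> : X = [set` undup s0] by rewrite Xs; apply/seteqP; split=> a /=; rewrite mem_undup.
by rewrite -fsbig_seq ?undup_uniq// sumEFin lee_fin hB ?undup_uniq.
Qed.

(** Meant for a difference quotient minus a derivative. Square summability has to be known before
    [ell2_norm] dominates the coordinates, since [fine] sends an infinite sum to 0. *)
Lemma ell2_lincomb (c : R[i]) f g h : ell2 f -> ell2 g -> ell2 h ->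
  ell2 (fun a => c * (f a - g a) - h a).
Proof.
move=> /ell2P[B1 h1] /ell2P[B2 h2] /ell2P[B3 h3]; apply/ell2P.
exists (3 * (normc c ^+ 2 * B1 + normc c ^+ 2 * B2 + B3)) => s us.
have c2 : 0 <= normc c ^+ 2 by exact: sqr_ge0.
have k1 := ler_wpM2l c2 (h1 s us).
have k2 := ler_wpM2l c2 (h2 s us).
apply: (@le_trans _ _ (3 * (normc c ^+ 2 * \sum_(a <- s) normc (f a) ^+ 2 +
   normc c ^+ 2 * \sum_(a <- s) normc (g a) ^+ 2 + \sum_(a <- s) normc (h a) ^+ 2))).
  rewrite !mulr_sumr -!big_split/= mulr_sumr; apply: ler_sum => a _.
  have e1 := normcB (c * (f a - g a)) (h a).
  have e2 := normcB (f a) (g a).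
  rewrite normcM in e1.
  have e3 := ler_wpM2l (normc_ge0 c) e2.
  have e0 := normc_ge0 (c * (f a - g a) - h a).
  apply: (@le_trans _ _ ((normc c * normc (f a) + normc c * normc (g a) + normc (h a)) ^+ 2)).
    by apply: lerXn2r; rewrite ?nnegrE; lra.
  rewrite -!exprMn; move: (normc c * normc (f a)) (normc c * normc (g a)) (normc (h a)) => x y z.
  have := sqr_ge0 (x - y); have := sqr_ge0 (x - z); have := sqr_ge0 (y - z); nra.
by rewrite ler_wpM2l// lerD ?h3// lerD.
Qed.

Lemma normc_le_ell2_norm f a : ell2 f -> normc (f a) <= ell2_norm f.
Proof.
move=> hf; have f0 b : 0 <= normc (f b) ^+ 2 by exact: sqr_ge0.
rewrite -[leLHS]ger0_norm ?normc_ge0// -sqrtr_sqr ler_wsqrtr//.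
rewrite -lee_fin fineK; last first.
  by rewrite ge0_fin_numE// esum_ge0// => b _; rewrite lee_fin.
apply: esum_ge; exists [set a]; first by split => //; exact: finite_set1.
by rewrite fsbig_set1.
Qed.

End SquareSummableFamilies.

Section C1Families.
Context {R : realType} {A : countType}.
Variables (u u' : R -> A -> R[i]).
Hypothesis hC1 : C1_ell2 u u'.

Lemma C1_ell2_uniform (t e : R) : t \in `[0, 1] -> 0 < e ->
  exists2 d, 0 < d & forall s, s \in `[0, 1] -> `|s - t| < d -> s != t ->
    forall a, normc (((s - t)^-1)%:C * (u s a - u t a) - u' t a) <= e.
Proof.
move=> t01 e0; have [hu hu' hlim _] := hC1.
have /cvgrPdist_le/(_ _ e0)[d /= d0 hd] := hlim t t01.
exists d => // s s01 st nst a.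
have := hd s; rewrite /ball_/= distrC => /(_ st nst s01).
rewrite sub0r normrN ger0_norm ?sqrtr_ge0//; apply: le_trans.
by apply: (@normc_le_ell2_norm _ _ (fun a => _)); apply: ell2_lincomb; [exact: hu|exact: hu|exact: hu'].
Qed.

Lemma C1_ell2_lipschitz (t : R) : t \in `[0, 1] ->
  exists2 d, 0 < d & forall s, s \in `[0, 1] -> `|s - t| < d ->
    forall a, normc (u s a - u t a) <= `|s - t| * (1 + ell2_norm (u' t)).
Proof.
move=> t01; have [d d0 hd] := C1_ell2_uniform t01 ltr01.
have [_ hu' _ _] := hC1.
exists d => // s s01 st a; have [->|nst] := eqVneq s t.
  by rewrite !subrr normc0 normr0 mul0r.
have h1 := hd s s01 st nst a.
have st0 : s - t != 0 by rewrite subr_eq0.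
have -> : u s a - u t a = (s - t)%:C * ((((s - t)^-1)%:C * (u s a - u t a) - u' t a) + u' t a).
  by rewrite subrK mulrA -rmorphM/= mulfV// mul1r.
rewrite normcM normc_real ler_wpM2l// (le_trans (normcD _ _))// lerD//.
by apply: normc_le_ell2_norm; exact: hu'.
Qed.

(** The Lipschitz estimate bounds all coordinates at once near each time; compactness of [0,1] makes
    the bound global. *)
Lemma C1_ell2_bounded : exists2 M, 0 < M &
  forall a (t : R), 0 <= t <= 1 -> normc (u t a) <= M.
Proof.
have [hu hu' _ _] := hC1.
pose P (M t : R) := 0 <= t <= 1 -> forall a, normc (u t a) <= M.
have : \forall M \near +oo, `[0, 1]%classic `<=` P M.
  apply: ((compact_near_coveringP `[(0:R), 1]%classic).1 (@segment_compact _ _ _)).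
  move=> t /= t01; have [d d0 hd] := C1_ell2_lipschitz t01.
  pose M0 := ell2_norm (u t) + d * (1 + ell2_norm (u' t)).
  exists ([set s | `|s - t| < d], [set M | M0 < M]) => /=.
    split; first by exists d => // s /=; rewrite distrC.
    by exists M0; split; rewrite ?num_real.
  move=> [s M]/= [st MM] s01 a.
  have h1 := hd s s01 st a.
  have h2 := normc_le_ell2_norm a (hu t t01).
  have h3 : `|s - t| * (1 + ell2_norm (u' t)) <= d * (1 + ell2_norm (u' t)).
    by rewrite ler_wpM2r ?addr_ge0 ?sqrtr_ge0// ltW.
  rewrite -(subrK (u t a) (u s a)) (le_trans (normcD _ _))//.
  by move: MM; rewrite /M0; lra.
move=> [M [_ hM]]; exists (`|M| + 1); first by rewrite ltr_pwDr.
by move=> a t t01; apply: (hM (`|M| + 1) _ t) => //=; rewrite ltr_pwDr ?ler_norm.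
Qed.

Lemma C1_ell2_cdiff a : cdiff (u^~ a) (u'^~ a).
Proof.
have key (f f' : R -> R) :
    (forall t, t \in `[0, 1] -> forall e, 0 < e -> exists2 d, 0 < d & forall s, s \in `[0, 1] ->
       `|s - t| < d -> s != t -> `|(s - t)^-1 * (f s - f t) - f' t| <= e) ->
    (forall t, t \in `[0, 1] -> exists2 C, 0 < C & exists2 d, 0 < d & forall s,
       s \in `[0, 1] -> `|s - t| < d -> `|f s - f t| <= `|s - t| * C) ->
    rdiff f f'.
  move=> hd hlip; split=> [t t01|].
    have t01' : t \in `[0, 1] by exact: subset_itv_oo_cc.
    have lim : h^-1 *: ((f \o shift t) (h *: (1 : R)) - f t) @[h --> 0^'] --> f' t.
      apply/cvgrPdist_le => e e0; have [d d0 hs] := hd t t01' e e0.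
      move: t01; rewrite in_itv/= => /andP[t0 t1].
      exists (Num.min d (Num.min t (1 - t))); first by rewrite /= !lt_min d0 t0 subr_gt0.
      move=> h /=; rewrite sub0r normrN !lt_min => /andP[hd' /andP[ht ht1]] h0.
      rewrite distrC /shift/= scaler1.
      have := hs (h + t); rewrite addrK; apply => //.
        by move: ht ht1; rewrite !ltr_norml in_itv/= => /andP[? ?] /andP[? ?]; apply/andP; split; lra.
      by rewrite -subr_eq0 addrK.
    by apply: DeriveDef; [apply/cvg_ex; exists (f' t)|exact/cvg_lim].
  apply/subspace_continuousP => t /= t01; have [C C0 [d d0 hC]] := hlip t t01.
  apply/cvgrPdist_le => e e0.
  exists (Num.min d (e / C)); first by rewrite /= lt_min d0 divr_gt0.
  move=> s /=; rewrite lt_min distrC => /andP[sd se] s01.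
  rewrite distrC (le_trans (hC s s01 sd))// -ler_pdivlMr// ltW//.
have dist t : t \in `[0, 1] -> exists2 C, 0 < C & exists2 d, 0 < d & forall s,
    s \in `[0, 1] -> `|s - t| < d -> normc (u s a - u t a) <= `|s - t| * C.
  move=> t01; have [d d0 hd] := C1_ell2_lipschitz t01.
  exists (1 + ell2_norm (u' t)); first by rewrite ltr_pwDl ?sqrtr_ge0.
  by exists d => // s s01 st; exact: hd.
split; apply: key => t t01.
- move=> e e0; have [d d0 hd] := C1_ell2_uniform t01 e0; exists d => // s s01 st nst.
  apply: le_trans (hd s s01 st nst a); apply: le_trans (normc_ge_normRe _).
  by case: (u s a) => ? ?; case: (u t a) => ? ?; case: (u' t a) => ? ?; rewrite /= mul0r subr0.
- have [C C0 [d d0 hd]] := dist t t01; exists C => //; exists d => // s s01 st.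
  apply: le_trans (hd s s01 st); apply: le_trans (normc_ge_normRe _).
  by case: (u s a) => ? ?; case: (u t a).
- move=> e e0; have [d d0 hd] := C1_ell2_uniform t01 e0; exists d => // s s01 st nst.
  apply: le_trans (hd s s01 st nst a); apply: le_trans (normc_ge_normIm _).
  by case: (u s a) => ? ?; case: (u t a) => ? ?; case: (u' t a) => ? ?; rewrite /= mul0r addr0.
- have [C C0 [d d0 hd]] := dist t t01; exists C => //; exists d => // s s01 st.
  apply: le_trans (hd s s01 st); apply: le_trans (normc_ge_normIm _).
  by case: (u s a) => ? ?; case: (u t a).
Qed.

End C1Families.

(** * Rows of the matrix of a web-like system *)

Section WebRows.
Context {R : realType} {A : countType} {N : nat}.
Variables (L : A -> A -> R) (nu : 'I_N -> nat -> A).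
Hypothesis hweb : web_like L nu.
Implicit Types (a b : A) (c : 'I_N) (f : A -> R[i]).

Lemma channel_neq c d k n : nu c k.+1 = nu d n -> exists2 n', n = n'.+1 & c = d /\ k = n'.
Proof.
case: n => [e|n e]; last by exists n => //; exact: (web_distinct hweb e).
have hd : core_part nu (nu d 0) by exact: (web_core_root hweb).
by exfalso; apply: hd; exists c, k.
Qed.

Lemma channel_edge c k b : L (nu c k.+1) b != 0 ->
  [\/ b = nu c k, b = nu c k.+1 | b = nu c k.+2].
Proof.
move=> Lb; have [->|nb] := eqVneq b (nu c k.+1); first by constructor 2.
have /(web_channel hweb) [->|->] : edge L (nu c k.+1) b by rewrite /edge/= eq_sym nb.
- by constructor 1.
- by constructor 3.
Qed.

Lemma channel_weight c k : L (nu c k.+1) (nu c k) != 0 /\ L (nu c k.+1) (nu c k.+2) != 0.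
Proof.
have e1 : edge L (nu c k.+1) (nu c k) by apply/(web_channel hweb); left.
have e2 : edge L (nu c k.+1) (nu c k.+2) by apply/(web_channel hweb); right.
by move: e1 e2; rewrite /edge/= => /andP[_ ->] /andP[_ ->].
Qed.

Lemma web_F_finite : finite_set (web_F nu).
Proof.
rewrite finite_setU; split; first exact: (web_core_finite hweb).
have -> : [set a | exists c, a = nu c 1%N] = (fun c => nu c 1%N) @` [set: 'I_N].
  by apply/seteqP; split=> a /= [c]; [move=> ->; exists c|move=> _ <-; exists c].
exact: finite_image.
Qed.

Lemma core_neighbour a b : core_part nu a -> L a b != 0 -> web_F nu b.
Proof.
move=> ca Lab; have [cb|] := pselect (core_part nu b); first by left.
move=> /contrapT cb; right.
have [h _] := web_attach hweb ca cb.
by have [c [_ ->]] := h Lab; exists c.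
Qed.

Lemma row_finite a : exists2 s : seq A, uniq s & forall b, b \notin s -> L a b = 0.
Proof.
have [ca|/contrapT[c [k ->]]] := pselect (core_part nu a).
  have [s0 Fs] := (finite_seqP _).1 web_F_finite.
  exists (undup s0); first exact: undup_uniq.
  move=> b; rewrite mem_undup => nb; apply/eqP; apply: contraNT nb.
  by move=> /(core_neighbour ca); rewrite Fs.
exists (undup [:: nu c k; nu c k.+1; nu c k.+2]); first exact: undup_uniq.
move=> b; rewrite mem_undup => nb; apply/eqP; apply: contraNT nb.
by move=> /channel_edge[]->; rewrite !inE eqxx ?orbT.
Qed.

Lemma matrix_action_row a f (s : seq A) : uniq s -> (forall b, b \notin s -> L a b = 0) ->
  matrix_action L f a = \sum_(b <- s) (L a b)%:C * f b.
Proof.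
by move=> us hs; apply: csum_finite_support => // b /hs ->; rewrite mul0r.
Qed.

Lemma matrix_action_channel c k f : matrix_action L f (nu c k.+1) =
  (L (nu c k.+1) (nu c k))%:C * f (nu c k) +
  (L (nu c k.+1) (nu c k.+1))%:C * f (nu c k.+1) +
  (L (nu c k.+1) (nu c k.+2))%:C * f (nu c k.+2).
Proof.
rewrite (@matrix_action_row _ _ [:: nu c k; nu c k.+1; nu c k.+2]).
- by rewrite !big_cons big_nil addr0 addrA.
- rewrite /= !inE !negb_or !andbT; apply/andP; split; last first.
    by apply/eqP => /channel_neq[n' [<-] [_ /eqP]]; rewrite ltn_eqF.
  apply/andP; split; apply/eqP => /esym/channel_neq[n' kn [_ e]].
    by move: kn; rewrite -e => /eqP; rewrite ltn_eqF.
  by move: kn; rewrite -e => /eqP; rewrite ltn_eqF.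
- move=> b nb; apply/eqP; apply: contraNT nb.
  by move=> /channel_edge[]->; rewrite !inE eqxx ?orbT.
Qed.

Lemma matrix_action_free : exists K0 : nat, forall c k f, (K0 <= k)%N ->
  matrix_action L f (nu c k.+1) = 2 * f (nu c k.+1) - f (nu c k) - f (nu c k.+2).
Proof.
have [K0 [_ h]] := web_free hweb; exists K0 => c k f Kk.
have hL n : (K0 <= n)%N -> L (nu c n) (nu c n.+1) = -1.
  by move=> /(h c)[<- _]; rewrite opprK.
have [_ d] := h c k.+1 (leqW Kk).
rewrite matrix_action_channel (web_sym hweb _ (nu c k)) !hL ?d//; last exact: leqW.
by rewrite rmorphN1 (rmorph_nat (@real_complex R) 2); ring.
Qed.

(** All rows are finite, and all but finitely many are free rows, whose absolute row sum is 2 + 1 +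
    1 = 4. The sup norm thus replaces the operator norm on ell^2. *)
Lemma matrix_action_sup_bounded : exists2 Lam, 0 < Lam & forall a f (M : R),
  (forall b, normc (f b) <= M) -> normc (matrix_action L f a) <= Lam * M.
Proof.
have row a : exists Lam, 0 <= Lam /\ forall f (M : R),
    (forall b, normc (f b) <= M) -> normc (matrix_action L f a) <= Lam * M.
  have [s us hs] := row_finite a; exists (\sum_(b <- s) `|L a b|).
  split=> [|f M hM]; first exact: sumr_ge0.
  rewrite (matrix_action_row _ us hs) (le_trans (normc_sum _ _ _))// mulr_suml.
  by apply: ler_sum => b _; rewrite normcM normc_real ler_wpM2l.
have [Lam hLam] := choice row.
have [K0 hfree] := matrix_action_free.
have [s0 Es] : exists s : seq A, core_part nu `|`
    [set nu p.1 (p.2 : nat).+1 | p in [set: 'I_N * 'I_K0]] = [set` s].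
  by apply/finite_seqP; rewrite finite_setU; split;
    [exact: (web_core_finite hweb)|exact: finite_image].
exists (4 + \sum_(a <- undup s0) Lam a).
  by rewrite ltr_pwDl// sumr_ge0// => a _; case: (hLam a).
move=> a f M hM; have M1 := le_trans (normc_ge0 _) (hM a).
have S0 : 0 <= \sum_(a <- undup s0) Lam a by rewrite sumr_ge0// => b _; case: (hLam b).
have [as0|as0] := boolP (a \in s0).
  rewrite (le_trans ((hLam a).2 f M hM))// ler_wpM2r//.
  rewrite (bigD1_seq a) ?undup_uniq ?mem_undup//= addrCA lerDl addr_ge0//.
  by rewrite sumr_ge0// => b _; case: (hLam b).
have nE : ~ (core_part nu `|` [set nu p.1 (p.2 : nat).+1 | p in [set: 'I_N * 'I_K0]]) a.
  by rewrite Es; apply/negP.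
have [c [k ak]] : channel_part nu a by apply: contrapT => ca; apply: nE; left.
have Kk : (K0 <= k)%N.
  rewrite leqNgt; apply/negP => kK; apply: nE; right.
  by exists (c, Ordinal kK).
rewrite ak hfree// (@le_trans _ _ (4 * M))//; last by rewrite ler_wpM2r// lerDl.
have h1 := normcB (2 * f (nu c k.+1) - f (nu c k)) (f (nu c k.+2)).
have h2 := normcB (2 * f (nu c k.+1)) (f (nu c k)).
rewrite normcM normc_nat in h2.
have := hM (nu c k); have := hM (nu c k.+1); have := hM (nu c k.+2); lra.
Qed.

End WebRows.

(** * Uniqueness, and propagation of zeros from vertex to vertex *)

Section WebEvolution.
Context {R : realType} {A : countType} {N : nat}.
Variables (L : A -> A -> R) (nu : 'I_N -> nat -> A) (u u' : R -> A -> R[i]).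
Hypothesis hweb : web_like L nu.
Hypothesis hC1 : C1_ell2 u u'.
Hypothesis heq : forall (t : R) (a : A), t \in `[0, 1] ->
  u' t a = 'i%C * matrix_action L (u t) a.
Implicit Types (a b : A) (c : 'I_N).

(** Picard iteration in the sup norm weighted by exp(2 Lam |t - t1|): integrating the equation from
    t1 halves the weighted bound, in either direction of time. *)
Lemma sup_norm_uniqueness (t1 : R) : 0 <= t1 <= 1 ->
  (forall a, u t1 a = 0) -> forall (t : R) a, 0 <= t <= 1 -> u t a = 0.
Proof.
move=> /andP[t10 t11] ut1.
have [M M0 hM] := C1_ell2_bounded hC1.
have [Lam Lam0 hLam] := matrix_action_sup_bounded hweb.
pose E (t : R) := expR (2 * Lam * `|t - t1|).
have E0 t : 0 < E t by exact: expR_gt0.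
have E1 t : 1 <= E t by rewrite -expR0 ler_expR !mulr_ge0// ltW.
have key j (t : R) a : 0 <= t <= 1 -> normc (u t a) <= M / 2 ^+ j * E t.
  elim: j t a => [|j IH] t a /[dup] t01 /andP[t0 tle1].
    by rewrite expr0 divr1 (le_trans (hM a t t01))// ler_peMr// ltW.
  set X := M / 2 ^+ j.+1.
  have hX : M / 2 ^+ j = 2 * X by rewrite /X exprS; field; rewrite gt_eqF ?exprn_gt0.
  have X0 : 0 < X by rewrite divr_gt0 ?exprn_gt0.
  have hd s : 0 < s < 1 -> normc (u' s a) <= 2 * Lam * X * E s.
    move=> /andP[s0 s1]; have s01 : 0 <= s <= 1 by rewrite !ltW.
    rewrite heq ?in_itv// normcM normc_i mul1r.
    rewrite (le_trans (hLam a _ _ (fun b => IH s b s01)))// hX.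
    by rewrite le_eqVlt; apply/orP; left; apply/eqP; ring.
  have cu := C1_ell2_cdiff hC1 a.
  have hg (sg : R) := rdiffZ (sg * X) (rdiff_affine_comp (sg * (2 * Lam)) t1 (@is_derive_expR R)).
  have [tt1|tt1] := leP t1 t.
    have h := cdiff_le cu (hg 1) _ t10 tt1 tle1.
    rewrite !mul1r subrr mulr0 expR0 mulr1 ut1 subr0 in h.
    rewrite /E ger0_norm ?subr_ge0//; apply: (le_trans (h _)); last by rewrite gerBl ltW.
    move=> s; rewrite in_itv/= => /andP[s0 s1].
    rewrite (le_trans (hd s _)) ?(le_lt_trans t10 s0) ?(lt_le_trans s1)//.
    rewrite /E ger0_norm ?subr_ge0 ?(ltW s0)//.
    by rewrite le_eqVlt; apply/orP; left; apply/eqP; ring.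
  have h := cdiff_le cu (hg (-1)) _ t0 (ltW tt1) t11.
  rewrite subrr mulr0 expR0 mulr1 ut1 sub0r normc_opp in h.
  have EN s : s <= t1 -> E s = expR (-1 * (2 * Lam) * (s - t1)).
    by move=> st; rewrite /E ler0_norm ?subr_le0//; congr expR; ring.
  rewrite (EN t (ltW tt1)); apply: (le_trans (h _)).
    move=> s; rewrite in_itv/= => /andP[s0 s1].
    rewrite (le_trans (hd s _)) ?(le_lt_trans t0 s0) ?(lt_le_trans s1)//.
    rewrite EN ?(ltW s1)//.
    by rewrite le_eqVlt; apply/orP; left; apply/eqP; ring.
  by lra.
move=> t a t01; apply: ComplexField.Normc.eq0_normc; apply/eqP.
rewrite eq_le normc_ge0 andbT; apply/ler_addgt0Pl => e e0; rewrite addr0.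
have : (2^-1 : R) ^+ n @[n --> \oo] --> (0 : R).
  by apply: cvg_expr; rewrite ger0_norm// invf_lt1// ltr1n.
have ME : 0 < M * E t by rewrite mulr_gt0.
move=> /cvgrPdist_le/(_ _ (divr_gt0 e0 ME)) [n _ /(_ n (leqnn n))].
rewrite sub0r normrN ger0_norm ?exprn_ge0// ler_pdivlMr// => hn.
rewrite (le_trans (key n t a t01))// (le_trans _ hn)// exprVn.
by rewrite le_eqVlt; apply/orP; left; apply/eqP; ring.
Qed.

(** A neighbourhood of 1/2 rather than the point, so that the time derivative vanishes as well and
    the equation can be used again. *)
Definition vanishes_near_half a := \forall t \near (2^-1 : R), u t a = 0.

Lemma near_half_in01 : \forall t \near (2^-1 : R), t \in `]0, 1[.
Proof. by apply: near_in_itvoo; rewrite in_itv/= invr_gt0 ltr0n invf_lt1// ltr1n. Qed.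

Lemma vanishes_near_half_derivative a : vanishes_near_half a ->
  \forall t \near (2^-1 : R), u' t a = 0.
Proof.
move=> /near_join za; have h01 := near_half_in01.
have [[dr _] [di _]] := C1_ell2_cdiff hC1 a.
near=> t.
have t01 : t \in `]0, 1[ by near: t.
have zt : \forall s \near t, u s a = 0 by near: t.
have zero (f : R -> R) l : is_derive t 1 f l -> (\forall s \near t, f s = 0) -> l = 0.
  move=> df f0; have := @near_eq_is_derive R R R f (cst 0) t 1 l f0 df.
  by move=> [_ <-]; exact: derive_cst.
apply/eqP; rewrite eq_complex; apply/andP; split; apply/eqP.
- by apply: zero (dr t t01) _; apply: filterS zt => s ->.
- by apply: zero (di t t01) _; apply: filterS zt => s ->.
Unshelve. all: by end_near. Qed.

(** Near 1/2 the equation at [a] reads 0 = i L(a,b) u(t,b), every other term being zero. *)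
Lemma vanishes_near_half_propagates a b : L a b != 0 -> vanishes_near_half a ->
  (forall b', L a b' != 0 -> b' != b -> vanishes_near_half b') -> vanishes_near_half b.
Proof.
move=> Lab za zb; have h01 := near_half_in01.
have [s us hs] := row_finite hweb a.
have dz := vanishes_near_half_derivative za.
(* Finiteness of the row gives one neighbourhood common to all neighbours. *)
have zs : \forall t \near (2^-1 : R), forall b', b' \in s -> L a b' != 0 -> b' != b -> u t b' = 0.
  elim: s {us hs} => [|b1 s IH]; first by near=> t => b'; rewrite in_nil.
  have [/andP[L1 n1]|n1] := boolP ((L a b1 != 0) && (b1 != b)).
    apply: filterS2 (zb b1 L1 n1) IH => t z1 zt b'; rewrite inE => /orP[/eqP->//|]; exact: zt.
  apply: filterS IH => t zt b'; rewrite inE => /orP[/eqP-> L1 n2|]; last exact: zt.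
  by rewrite L1 n2 in n1.
have sb : b \in s by apply: contraNT Lab => /hs ->.
rewrite /vanishes_near_half; near=> t.
have t01 : t \in `]0, 1[ by near: t.
have := heq a (subset_itv_oo_cc t01).
have -> : u' t a = 0 by near: t.
rewrite (matrix_action_row _ us hs) (bigD1_seq b)//= big1_seq; last first.
  move=> b' /andP[nb' sb']; have [->|L'] := eqVneq (L a b') 0; first by rewrite mul0r.
  rewrite (_ : u t b' = 0) ?mulr0//; move: b' sb' L' nb'; near: t; exact: zs.
rewrite addr0 => /esym/eqP; rewrite !mulf_eq0 => /orP[|/orP[|/eqP//]].
  by rewrite eq_complex/= oner_eq0 andbF.
by rewrite eq_complex/= eqxx andbT (negbTE Lab).
Unshelve. all: by end_near. Qed.

End WebEvolution.

(** * Vanishing along the channels and through the core *)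

Section WebVanishing.
Context {R : realType} {A : countType} {N : nat}.
Variables (L : A -> A -> R) (nu : 'I_N -> nat -> A) (u u' : R -> A -> R[i]).
Hypothesis hweb : web_like L nu.
Hypothesis hC1 : C1_ell2 u u'.
Hypothesis heq : forall (t : R) (a : A), t \in `[0, 1] ->
  u' t a = 'i%C * matrix_action L (u t) a.

Let vanish a := vanishes_near_half u a.

Lemma channel_vanishing_down c k :
  vanish (nu c k.+1) -> vanish (nu c k.+2) -> vanish (nu c k).
Proof.
move=> z1 z2; have [w0 _] := channel_weight hweb c k.
apply: (vanishes_near_half_propagates hweb hC1 heq w0 z1) => b Lb nb.
by have [e|->|->] := channel_edge hweb Lb => //; rewrite e eqxx in nb.
Qed.

Lemma channel_vanishing_up c k :
  vanish (nu c k) -> vanish (nu c k.+1) -> vanish (nu c k.+2).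
Proof.
move=> z0 z1; have [_ w2] := channel_weight hweb c k.
apply: (vanishes_near_half_propagates hweb hC1 heq w2 z1) => b Lb nb.
by have [->|->|e] := channel_edge hweb Lb => //; rewrite e eqxx in nb.
Qed.

Lemma channel_vanishing c (eps C : R) : 0 < eps -> 0 < C ->
  (forall (k : nat) (t : R), (0 < k)%N -> t = 0 \/ t = 1 ->
    `|u t (nu c k)| <= (C * (expR 1 / ((2 + eps) * k%:R)) ^+ k)%:C) ->
  forall k, vanish (nu c k).
Proof.
move=> eps0 C0 hdecay.
have [K0 hfree] := matrix_action_free hweb.
have [M M0 hM] := C1_ell2_bounded hC1.
set beta := 2 + eps; have beta2 : 2 < beta by rewrite /beta ltrDl.
have beta0 : 0 < beta by lra.
have far K : (K0 <= K)%N -> vanish (nu c K).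
  move=> KK; have b2 : beta^-1 < 2^-1 by rewrite ltf_pV2 ?posrE.
  have hv k : cdiff (u^~ (nu c (K + k)%N)) (u'^~ (nu c (K + k)%N)).
    exact: C1_ell2_cdiff.
  have hf k (t : R) : t \in `]0, 1[ -> u' t (nu c (K + k.+1)%N) =
      'i%C * (2 * u t (nu c (K + k.+1)%N) - u t (nu c (K + k)%N) - u t (nu c (K + k.+2)%N)).
    move=> t01; rewrite heq ?subset_itv_oo_cc// !addnS hfree//.
    exact: leq_trans KK (leq_addr _ _).
  have hd k (t : R) : (0 < k)%N -> t = 0 \/ t = 1 -> normc (u t (nu c (K + k)%N)) <=
      C * (expR 1 / (beta * (K + k)%:R)) ^+ (K + k).
    by move=> k0 ht; rewrite -lecR; apply: hdecay => //; rewrite addn_gt0 k0 orbT.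
  have b3 : \forall t \near (2^-1 : R), t \in `]beta^-1, (1 - beta^-1)[.
    by apply: near_in_itvoo; rewrite in_itv/=; apply/andP; split; lra.
  apply: filterS b3 => t; rewrite in_itv/= => /andP[t1 t2].
  have := @tail_vanishing R _ _ hv hf M (fun k t t01 => hM _ _ t01) beta C K beta0 C0 hd t t1.
  by rewrite addn0; apply; lra.
(* The equation is of second order in k, so two consecutive zeros are carried down from the free
   part. *)
have down j : forall k, (K0 <= k + j)%N -> vanish (nu c k) /\ vanish (nu c k.+1).
  elim: j => [|j IH] k kj.
    by rewrite addn0 in kj; split; apply: far => //; exact: leqW.
  by have [|z1 z2] := IH k.+1; [rewrite addSnnS|split=> //; exact: channel_vanishing_down].
by move=> k; case: (down K0 k (leq_addl _ _)).
Qed.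

(** An extension looks only at neighbours inside F, while the equation at b involves all of them.
    The two differ only at b = nu(1), whose neighbour nu(2) lies outside F. The invariant that nu(1)
    comes with nu(0) excludes this case: the only neighbour of nu(1) in F is then already in the
    set, so nu(1) allows no extension. *)
Lemma extension_chain_vanishing (D E : set A) :
  extension_chain L (web_F nu) D E -> D `<=` web_F nu ->
  (forall c, D (nu c 1%N) -> D (nu c 0%N)) -> (forall a, D a -> vanish a) ->
  forall a, E a -> vanish a.
Proof.
move=> chain DF D10 Dz.
suff [_ _] : [/\ E `<=` web_F nu, (forall c, E (nu c 1%N) -> E (nu c 0%N)) &
  (forall a, E a -> vanish a)] by [].
elim: chain => {E} [|E E' _ [EF E10 Ez] [b [a [Eb [[[Fa nEa] [_ Fb ab]] ua] ->]]]].
  by split.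
move: ab => /andP[nab Lab].
have Lba : L b a != 0 by rewrite (web_sym hweb).
have zab : vanish a.
  apply: (vanishes_near_half_propagates hweb hC1 heq Lba (Ez b Eb)) => b' Lb' nb'.
  apply: Ez; apply: contrapT => nEb'.
  have b'b : b' != b by apply: contra_notN nEb' => /eqP ->.
  have edge_b' : edge L b' b by rewrite /edge/= b'b (web_sym hweb).
  case: (Fb) => [cb|[c bc]].
    have Fb' := core_neighbour hweb cb Lb'.
    by move/eqP: nb'; apply; apply/esym/ua; split.
  have E0 := E10 c; rewrite -bc in E0.
  have Lb1 := Lba; rewrite bc in Lb1.
  have [aE|aE|aE] := channel_edge hweb Lb1.
  - by apply: nEa; rewrite aE; exact: E0.
  - by move/eqP: nab; rewrite bc.
  - case: Fa => [ca|[d ad]]; first by apply: ca; exists c, 1%N.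
    by rewrite aE in ad; have [n' [<-] [_]] := channel_neq hweb ad.
split.
- by move=> x [/EF//|->].
(* If nu(1) is the vertex just added, it was reached from a neighbour in F, which can only be nu(0);
   so the invariant persists. *)
- move=> c [/E10|c1a]; first by left.
  left; rewrite -c1a in Lba.
  have Lab' : L (nu c 1%N) b != 0 by rewrite (web_sym hweb).
  have [bE|bE|bE] := channel_edge hweb Lab'.
  + by rewrite -bE.
  + by move/eqP: nab; rewrite bE c1a.
  + case: Fb => [cb|[d bd]]; first by exfalso; apply: cb; exists c, 1%N.
    by rewrite bE in bd; have [n' [<-] [_]] := channel_neq hweb bd.
- by move=> x [/Ez//|->].
Qed.

End WebVanishing.

Theorem corollary4p3 (R : realType) (A : countType) (L : A -> A -> R)
  (N : nat) (nu : 'I_N -> nat -> A) (c0 : 'I_N) (u u' : R -> A -> R[i])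
  (hweb : web_like L nu)
  (hC1 : C1_ell2 u u')
  (heq : forall (t : R) (a : A), t \in `[0, 1] -> u' t a = 'i%C * matrix_action L (u t) a)
  (hdecay : forall c, c != c0 ->
    exists eps C : R, [/\ 0 < eps, 0 < C &
      forall (k : nat) (t : R), (0 < k)%N -> t = 0 \/ t = 1 ->
        `|u t (nu c k)| <= (C * (expR 1 / ((2 + eps) * k%:R)) ^+ k)%:C])
  (hclosure : extension_closure L (web_F nu) (web_B nu c0) = web_F nu) :
  forall (t : R) (a : A), t \in `[0, 1] -> u t a = 0.
Proof.
have zc c k : c != c0 -> vanishes_near_half u (nu c k).
  by move=> /hdecay[eps [C [eps0 C00 h]]]; exact: (channel_vanishing hweb hC1 heq eps0 C00 h).
have [E maxE] := maximal_chain_end_exists L (web_B nu c0) (web_F_finite hweb).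
have EF := extension_closureE maxE; rewrite hclosure in EF.
have [chainE _] := maxE; rewrite -EF in chainE.
have F1 c : web_F nu (nu c 1%N) by right; exists c.
have F0 c : web_F nu (nu c 0%N) by left; exact: (web_core_root hweb).
have zF := extension_chain_vanishing hweb hC1 heq chainE.
have {}zF a : web_F nu a -> vanishes_near_half u a.
  apply: zF.
  - by move=> x [c [_ [->|->]]].
  - move=> c [d [dc [e|e]]].
      by have [n'] := channel_neq hweb e.
    have [n' _ [cd _]] := channel_neq hweb e; exists c; rewrite cd; split=> //; by left.
  - by move=> x [c [cc0 [->|->]]]; exact: zc.
have zA a : vanishes_near_half u a.
  have [ca|/contrapT[c [k ->]]] := pselect (core_part nu a).
    by apply: zF; left.
  (* No decay is assumed along the channel [c0]; its zeros climb from nu(0) and nu(1), both of which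
     lie in F. *)
  suff H : forall n, vanishes_near_half u (nu c n) /\ vanishes_near_half u (nu c n.+1).
    by case: (H k).
  elim=> [|n [z0 z1]]; first by split; apply: zF.
  by split=> //; exact: (channel_vanishing_up hweb hC1 heq z0 z1).
have half : 0 <= (2^-1 : R) <= 1 by rewrite invr_ge0 ler0n invf_le1// ler1n.
move=> t a; rewrite in_itv/= => t01.
apply: (sup_norm_uniqueness hweb hC1 heq half _ a t01) => b.
exact: nbhs_singleton (zA b).
Qed.
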